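(* Let $M(g,\varrho)$ be a simple $\mathfrak{D}(G)$-module, $\mathsf{M}=\mathsf{M}(g,\varrho)$ its Verma module, and $\mathsf{M}_{\mathsf{soc}}=\mathfrak{B}^{n_{top}}(V)\otimes M(g,\varrho)\subseteq\mathsf{M}$, where $n_{top}$ is the maximum degree of $\mathfrak{B}(V)$. Then the socle of $\mathsf{M}$ as a $\mathfrak{D}$-module is simple and equals $\mathfrak{B}(\overline V)\,\mathsf{M}_{\mathsf{soc}}$.
   Context: Throughout, $\Bbbk$ is an algebraically closed field of characteristic zero, $G$ is a finite non-abelian group, and $V$ is a (left-left) Yetter–Drinfeld module over $\Bbbk G$ whose Nichols algebra $\mathfrak{B}(V)=\bigoplus_{n\ge 0}\mathfrak{B}^n(V)$ is finite-dimensional. Modules are left modules. For a finite-dimensional Hopf algebra $H$, the Drinfeld double is $H\otimes H^*$ as a coalgebra, with multiplication $(h\otimes f)(h'\otimes f')=\langle f_{(1)},h'_{(1)}\rangle\langle f_{(3)},\mathcal{S}(h'_{(3)})\rangle\,(hh'_{(2)}\otimes f'f_{(2)})$; it contains $H$ and $H^{*op}$ as Hopf subalgebras. $\mathfrak{D}(G)$ is the Drinfeld double of $\Bbbk G$, and $\mathfrak{D}$ is the Drinfeld double of the bosonization $\mathfrak{B}(V)\#\Bbbk G$. Let $\Bbbk^G=(\Bbbk G)^*$ with basis $\{\delta_h\}$ dual to $G$. Let $\overline V$ be $V^*$ with the Yetter–Drinfeld structure over $\Bbbk^G$ given by $\langle f\cdot y,x\rangle=\langle f,\mathcal{S}(x_{(-1)})\rangle\langle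 y,x_{(0)}\rangle$ and $\langle y,g\cdot x\rangle=\langle y_{(-1)},g\rangle\langle y_{(0)},x\rangle$. One identifies $(\mathfrak{B}(V)\#\Bbbk G)^{*op}$ with $\mathfrak{B}(\overline V)\#\Bbbk^G$ (as graded Hopf algebras; $f\in\Bbbk^G$ acts as a functional on $\mathfrak{B}^0(V)\#\Bbbk G$ by $\langle f,g\rangle$ and vanishes in other degrees; $y\in\overline V$ acts by $x\#g\mapsto\langle y,x\rangle$ on $V\#\Bbbk G$ and vanishes in other degrees). Inside $\mathfrak{D}$, the subalgebra generated by $\Bbbk G$ and $\Bbbk^G$ is $\mathfrak{D}(G)$, multiplication gives a linear isomorphism $\mathfrak{B}(V)\otimes\mathfrak{D}(G)\otimes\mathfrak{B}(\overline V)\to\mathfrak{D}$, and $\mathfrak{D}$ is $\mathbb{Z}$-graded with $\deg V=-1$, $\deg\mathfrak{D}(G)=0$, $\deg\overline V=1$. $\mathfrak{D}^{\geq0}$ is the subalgebra generated by $\mathfrak{D}(G)$ and $\overline V$. Simple $\mathfrak{D}(G)$-modules: for $g\in G$ with centralizer $\mathcal{C}_g$ and an irreducible representation $(U,\varrho)$ of $\mathcal{C}_g$, $M(g,\varrho)=\Bbbk G\otimes_{\Bbbk\mathcal{C}_g}U$ with $f\cdot(x\otimes u)=\langle f,xgx^{-1}\rangle x\otimes u$ for $f\in\Bbbk^G$; every simple $\mathfrak{D}(G)$-module has this form. $M(g,\varrho)$ is a $\mathfrak{D}^{\geq 0}$-module with $\overline V$ acting by zero. The Verma module $\mathsf{M}(g,\varrho)=\mathfrak{D}\otimes_{\mathfrak{D}^{\geq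 0}}M(g,\varrho)$ equals $\mathfrak{B}(V)\otimes M(g,\varrho)$ as a $\mathfrak{D}(G)$-module. *)

(* Defs.v *)
(* All vector spaces are finite-dimensional.  Objects that mathematics        *)
(* determines up to unique isomorphism (Nichols algebra, bosonization,        *)
(* Drinfeld double, tensor product over a subalgebra) are given by a record   *)
(* on a carrier, the carrier being an arbitrary vectType or falgType;         *)
(* a term of the record says that the carrier, with the structure maps of     *)
(* the record, is a model of the object.                                      *)
From HB Require Import structures.
From mathcomp Require Import all_boot all_order all_fingroup all_algebra.
From mathcomp Require Import all_field.

Set Implicit Arguments.
Unset Strict Implicit.
Unset Printing Implicit Defensive.

Import GRing.Theory.
Local Open Scope ring_scope.

Reserved Notation "\sw_ ( a , b <- T ) E"
  (at level 41, E at level 41, a, b at level 50,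
   format "'[' \sw_ ( a ,  b  <-  T ) '/  '  E ']'").

(** * Tensor products and duals *)

Section Tensor.
Variable k : fieldType.

(* [U] (x) [V] in coordinates: [T i j] is the coefficient of e_i (x) e_j for
   the bases [vbasis {:U}] and [vbasis {:V}]. *)
Definition tens (U V : vectType k) : vectType k :=
  'M[k]_(\dim {:U}, \dim {:V}).

Definition pure (U V : vectType k) (u : U) (v : V) : tens U V :=
  \matrix_(i, j) (coord (vbasis {:U}) i u * coord (vbasis {:V}) j v).

(* The linear map on [U] (x) [V] induced by a bilinear map [b]; the notation
   [\sw_(a, b <- T) E] is Sweedler's: E = E(a, b) is bilinear and T = a (x) b
   with the summation understood. *)
Definition tlift (U V W : vectType k) (T : tens U V) (b : U -> V -> W) : W :=
  \sum_i \sum_j T i j *: b (vbasis {:U})`_i (vbasis {:V})`_j.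

Definition dual (V : vectType k) : vectType k := 'Hom(V, k^o).

Definition bilinear_map (X U W : vectType k) (t : X -> U -> W) : Prop :=
  (forall x, linear (t x)) /\ (forall u, linear (fun x => t x u)).

(* The span of the products b x y for x in X and y in Y, for b bilinear. *)
Definition span_prod (U V W : vectType k) (b : U -> V -> W)
    (X : {vspace U}) (Y : {vspace V}) : {vspace W} :=
  <<[seq b x y | x <- vbasis X, y <- vbasis Y]>>%VS.

(* [W], with [t], is the tensor product of [X] and [U] over (the algebra
   spanned by) a family of operators indexed by [A], acting on the right of
   [X] by [ra] and on the left of [U] by [la]. *)
Definition balanced_map (X U W : vectType k) (A : Type)
    (ra : A -> X -> X) (la : A -> U -> U) (t : X -> U -> W) : Prop :=
  bilinear_map t /\ forall a x u, t (ra a x) u = t x (la a u).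

Definition is_tensor_over (X U W : vectType k) (A : Type)
    (ra : A -> X -> X) (la : A -> U -> U) (t : X -> U -> W) : Prop :=
  balanced_map ra la t /\
  forall (N : vectType k) (s : X -> U -> N), balanced_map ra la s ->
    exists! phi : 'Hom(W, N), forall x u, phi (t x u) = s x u.

End Tensor.

Notation "\sw_ ( a , b <- T ) E" := (tlift T (fun a b => E)) : ring_scope.

(** * Modules, simple submodules, socle *)

Section Modules.
Variables (k : fieldType) (A : falgType k) (M : vectType k).
Variable act : A -> M -> M.

Definition is_module : Prop :=
  [/\ bilinear_map act,
      forall m, act 1 m = m
    & forall a b m, act (a * b) m = act a (act b m)].

Definition submodule (N : {vspace M}) : Prop :=
  forall a n, n \in N -> act a n \in N.

Definition simple_submodule (N : {vspace M}) : Prop :=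
  [/\ submodule N, N <> 0%VS
    & forall N' : {vspace M}, submodule N' -> (N' <= N)%VS ->
        N' = 0%VS \/ N' = N].

(* The socle is the sum of all simple submodules. *)
Definition in_socle (m : M) : Prop :=
  exists2 s : seq {vspace M},
    forall N, N \in s -> simple_submodule N & m \in (\sum_(N <- s) N)%VS.

End Modules.

(** * Yetter-Drinfeld modules and Nichols algebras over a group algebra *)

Section YetterDrinfeld.
Variables (k : fieldType) (gT : finGroupType).

(* Left-left Yetter-Drinfeld modules over the group algebra.  The coaction is
   v |-> \sum_g g (x) [ydpart g v]; coassociativity and counitality say that
   the [ydpart g] are orthogonal projections of sum 1. *)
Record yd_module (V : vectType k) := YDModule {
  ydact : gT -> 'End(V);
  ydpart : gT -> 'End(V);
  ydact1 : forall v, ydact 1%g v = v;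
  ydactM : forall g h v, ydact (g * h)%g v = ydact g (ydact h v);
  ydpart_coassoc : forall g h v,
    ydpart g (ydpart h v) = if g == h then ydpart g v else 0;
  ydpart_counit : forall v, \sum_g ydpart g v = v;
  ydpart_act : forall g h v,
    ydpart (h * g * h^-1)%g (ydact h v) = ydact h (ydpart g v)
}.

(* Hopf algebras in the braided category of Yetter-Drinfeld modules, whose
   braiding is v (x) w |-> \sum_t t.w (x) [ydpart t v]. *)
Record braided_hopf (R : falgType k) := BraidedHopf {
  bh_yd : yd_module R;
  bh_comul : 'Hom(R, tens R R);
  bh_counit : dual R;
  bh_antipode : 'End(R);
  (* unit and multiplication are morphisms of Yetter-Drinfeld modules *)
  bh_act1 : forall g, ydact bh_yd g 1 = 1;
  bh_actM : forall g x y,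
    ydact bh_yd g (x * y) = ydact bh_yd g x * ydact bh_yd g y;
  bh_part1 : forall g, ydpart bh_yd g 1 = (g == 1%g)%:R;
  bh_partM : forall g x y, ydpart bh_yd g (x * y) =
    \sum_t ydpart bh_yd t x * ydpart bh_yd (t^-1 * g)%g y;
  (* so are comultiplication, counit and antipode *)
  bh_comul_act : forall g x, bh_comul (ydact bh_yd g x) =
    \sw_(a, b <- bh_comul x) pure (ydact bh_yd g a) (ydact bh_yd g b);
  bh_comul_part : forall g x, bh_comul (ydpart bh_yd g x) =
    \sw_(a, b <- bh_comul x)
      \sum_t pure (ydpart bh_yd t a) (ydpart bh_yd (t^-1 * g)%g b);
  bh_counit_act : forall g x, bh_counit (ydact bh_yd g x) = bh_counit x;
  bh_counit_part : forall g x,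
    bh_counit (ydpart bh_yd g x) = if g == 1%g then bh_counit x else 0;
  bh_antipode_act : forall g x,
    bh_antipode (ydact bh_yd g x) = ydact bh_yd g (bh_antipode x);
  bh_antipode_part : forall g x,
    bh_antipode (ydpart bh_yd g x) = ydpart bh_yd g (bh_antipode x);
  bh_coassoc : forall x,
    \sw_(a, b <- bh_comul x) pure (bh_comul a) b =
    \sw_(a, b <- bh_comul x) \sw_(c, d <- bh_comul b) pure (pure a c) d;
  bh_counitl : forall x, \sw_(a, b <- bh_comul x) (bh_counit a *: b) = x;
  bh_counitr : forall x, \sw_(a, b <- bh_comul x) (bh_counit b *: a) = x;
  bh_comul1 : bh_comul 1 = pure 1 1;
  bh_comulM : forall x y, bh_comul (x * y) =
    \sw_(a, b <- bh_comul x) \sw_(c, d <- bh_comul y)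
      \sum_t pure (a * ydact bh_yd t c) (ydpart bh_yd t b * d);
  bh_counit1 : bh_counit 1 = 1;
  bh_counitM : forall x y, bh_counit (x * y) = bh_counit x * bh_counit y;
  bh_antipodel : forall x,
    \sw_(a, b <- bh_comul x) (bh_antipode a * b) = bh_counit x *: 1;
  bh_antipoder : forall x,
    \sw_(a, b <- bh_comul x) (a * bh_antipode b) = bh_counit x *: 1
}.

(* [R] is the Nichols algebra of [V]: a graded braided Hopf algebra whose
   degree 0 part is k.1, whose degree 1 part is (identified by [na_inj] with)
   [V], whose primitive elements are those of degree 1 and which is generated
   in degree 1.  The grading is given by the projections [na_proj n] onto the
   homogeneous components. *)
Record nichols_algebra (V : vectType k) (ydV : yd_module V) (R : falgType k) :=
NicholsAlgebra {
  na_hopf : braided_hopf R;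
  na_proj : nat -> 'End(R);
  na_inj : 'Hom(V, R);
  na_projK : forall m n x,
    na_proj m (na_proj n x) = if m == n then na_proj m x else 0;
  na_proj_sum : exists N, forall x, \sum_(n < N) na_proj n x = x;
  na_proj_act : forall n g x,
    na_proj n (ydact (bh_yd na_hopf) g x) = ydact (bh_yd na_hopf) g (na_proj n x);
  na_proj_part : forall n g x,
    na_proj n (ydpart (bh_yd na_hopf) g x) =
    ydpart (bh_yd na_hopf) g (na_proj n x);
  na_projM : forall m n x y,
    na_proj (m + n) (na_proj m x * na_proj n y) = na_proj m x * na_proj n y;
  na_proj_comul : forall i j n x, (i + j)%N != n ->
    \sw_(a, b <- bh_comul na_hopf (na_proj n x))
      pure (na_proj i a) (na_proj j b) = 0;
  na_proj_counit : forall n x, n != 0%N ->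
    bh_counit na_hopf (na_proj n x) = 0;
  na_proj_antipode : forall n x,
    na_proj n (bh_antipode na_hopf x) = bh_antipode na_hopf (na_proj n x);
  na_degree0 : limg (na_proj 0) = 1%VS;
  na_inj_inj : lker na_inj = 0%VS;
  na_inj_img : limg na_inj = limg (na_proj 1);
  na_inj_act : forall g v,
    na_inj (ydact ydV g v) = ydact (bh_yd na_hopf) g (na_inj v);
  na_inj_part : forall g v,
    na_inj (ydpart ydV g v) = ydpart (bh_yd na_hopf) g (na_inj v);
  na_primitive : forall x,
    bh_comul na_hopf x = pure x 1 + pure 1 x <-> x \in limg (na_proj 1);
  na_generated : agenv (limg (na_proj 1)) = fullv
}.

Definition is_top_degree (V : vectType k) (ydV : yd_module V) (R : falgType k)
    (B : nichols_algebra ydV R) (n : nat) : Prop :=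
  limg (na_proj B n) <> 0%VS /\
  forall m, (n < m)%N -> limg (na_proj B m) = 0%VS.

End YetterDrinfeld.

(** * Hopf algebras and the Drinfeld double *)

Section Hopf.
Variable k : fieldType.

Record hopf_algebra (H : falgType k) := HopfAlgebra {
  ha_comul : 'Hom(H, tens H H);
  ha_counit : dual H;
  ha_antipode : 'End(H);
  ha_coassoc : forall x,
    \sw_(a, b <- ha_comul x) pure (ha_comul a) b =
    \sw_(a, b <- ha_comul x) \sw_(c, d <- ha_comul b) pure (pure a c) d;
  ha_counitl : forall x, \sw_(a, b <- ha_comul x) (ha_counit a *: b) = x;
  ha_counitr : forall x, \sw_(a, b <- ha_comul x) (ha_counit b *: a) = x;
  ha_comul1 : ha_comul 1 = pure 1 1;
  ha_comulM : forall x y, ha_comul (x * y) =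
    \sw_(a, b <- ha_comul x) \sw_(c, d <- ha_comul y) pure (a * c) (b * d);
  ha_counit1 : ha_counit 1 = 1;
  ha_counitM : forall x y, ha_counit (x * y) = ha_counit x * ha_counit y;
  ha_antipodel : forall x,
    \sw_(a, b <- ha_comul x) (ha_antipode a * b) = ha_counit x *: 1;
  ha_antipoder : forall x,
    \sw_(a, b <- ha_comul x) (a * ha_antipode b) = ha_counit x *: 1
}.

(* The dual Hopf algebra: <f f', x> = <f, x_(1)> <f', x_(2)>, with unit the
   counit of [H], and <f_(1), x> <f_(2), y> = <f, x y>. *)
Definition dual_mul (H : falgType k) (hH : hopf_algebra H)
    (f f' : dual H) : dual H :=
  linfun (fun x : H => \sw_(a, b <- ha_comul hH x) (f a * f' b : k^o)).

Definition dual_basis (H : vectType k) (i : 'I_(\dim {:H})) : dual H :=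
  linfun (fun x : H => (coord (vbasis {:H}) i x : k^o)).

Definition dual_comul (H : falgType k) (f : dual H) : tens (dual H) (dual H) :=
  \sum_(i < \dim {:H}) \sum_(j < \dim {:H})
    f ((vbasis {:H})`_i * (vbasis {:H})`_j) *:
      pure (dual_basis i) (dual_basis j).

(* [dd_elt (pure h f)] is the element h (x) f of the double. *)
Record drinfeld_double (H : falgType k) (hH : hopf_algebra H)
    (D : falgType k) := DrinfeldDouble {
  dd_elt : 'Hom(tens H (dual H), D);
  dd_bij : bijective dd_elt;
  dd_one : dd_elt (pure 1 (ha_counit hH)) = 1;
  dd_mul : forall (h h' : H) (f f' : dual H),
    dd_elt (pure h f) * dd_elt (pure h' f') =
    \sw_(f1, f23 <- dual_comul f) \sw_(f2, f3 <- dual_comul f23)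
    \sw_(h1, h23 <- ha_comul hH h') \sw_(h2, h3 <- ha_comul hH h23)
      (f1 h1 * f3 (ha_antipode hH h3)) *:
        dd_elt (pure (h * h2) (dual_mul hH f' f2))
}.

End Hopf.

(** * Bosonization and the subalgebras of its double *)

Section Bosonization.
Variables (k : fieldType) (gT : finGroupType).

(* The bosonization of [R] by the group algebra: [bos_elt g r] is r # g, and
   \sum_g [bos_coord g h] # g is the expansion of h. *)
Record bosonization (R : falgType k) (B : braided_hopf gT R)
    (H : falgType k) (hH : hopf_algebra H) := Bosonization {
  bos_elt : gT -> 'Hom(R, H);
  bos_coord : gT -> 'Hom(H, R);
  bos_eltK : forall g t r,
    bos_coord g (bos_elt t r) = if g == t then r else 0;
  bos_coordK : forall h, \sum_g bos_elt g (bos_coord g h) = h;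
  bos_one : bos_elt 1%g 1 = 1;
  bos_mul : forall g t r s,
    bos_elt g r * bos_elt t s = bos_elt (g * t)%g (r * ydact (bh_yd B) g s);
  (* r_(1) # (r_(2))_(-1) g (x) (r_(2))_(0) # g *)
  bos_comul : forall g r, ha_comul hH (bos_elt g r) =
    \sw_(a, b <- bh_comul B r)
      \sum_t pure (bos_elt (t * g)%g a) (bos_elt g (ydpart (bh_yd B) t b));
  bos_counit : forall g r, ha_counit hH (bos_elt g r) = bh_counit B r
}.

Section Double.
Variables (V : vectType k) (ydV : yd_module gT V).
Variables (R : falgType k) (B : nichols_algebra ydV R).
Variables (H : falgType k) (hH : hopf_algebra H).
Variable bH : bosonization (na_hopf B) hH.
Variables (D : falgType k) (dD : drinfeld_double hH D).

Definition dbl_nichols (r : R) : D :=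
  dd_elt dD (pure (bos_elt bH 1%g r) (ha_counit hH)).

Definition dbl_grp (g : gT) : D :=
  dd_elt dD (pure (bos_elt bH g 1) (ha_counit hH)).

(* A function on the group as a functional on the bosonization: it sends
   r # g to f(g) times the scalar component of r. *)
Definition fun_functional (f : gT -> k) : dual H :=
  linfun (fun h : H =>
    \sum_g (f g * bh_counit (na_hopf B) (bos_coord bH g h) : k^o)).

Definition dbl_fun (f : gT -> k) : D := dd_elt dD (pure 1 (fun_functional f)).

(* An element y of V^* as a functional on the bosonization: it sends x # g to
   <y, x> for x in V and vanishes in degrees other than 1. *)
Definition vbar_functional (y : dual V) : dual H :=
  linfun (fun h : H =>
    \sum_g y ((na_inj B)^-1%VF (na_proj B 1 (bos_coord bH g h)))).

Definition dbl_vbar (y : dual V) : D := dd_elt dD (pure 1 (vbar_functional y)).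

Definition dbl_vbar_space : {vspace D} := limg (linfun dbl_vbar).

(* The Drinfeld double of the group, as the subalgebra generated by the group
   and the functions on it. *)
Definition dbl_DG : {vspace D} :=
  agenv (<<[seq dbl_grp g | g : gT]>> +
         <<[seq dbl_fun (fun x => (x == g)%:R) | g : gT]>>)%VS.

Definition dbl_ge0 : {vspace D} := agenv (dbl_DG + dbl_vbar_space)%VS.

(* The Nichols algebra of the dual of V, as a subalgebra of the double. *)
Definition dbl_nichols_bar : {vspace D} := agenv dbl_vbar_space.

End Double.
End Bosonization.

(** * Verma modules *)

Section Verma.
Variables (k : fieldType) (gT : finGroupType).

Definition is_irreducible_repr (cT : finGroupType) (U : vectType k)
    (rho : cT -> 'End(U)) : Prop :=
  [/\ forall u, rho 1%g u = u,
      forall x y u, rho (x * y)%g u = rho x (rho y u),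
      fullv <> 0%VS :> {vspace U}
    & forall X : {vspace U}, (forall x u, u \in X -> rho x u \in X) ->
        X = 0%VS \/ X = fullv].

(* The group algebra as a bimodule over the group. *)
Definition grp_alg : vectType k := {ffun gT -> k^o}.
Definition ga_elt (x : gT) : grp_alg := [ffun y => (y == x)%:R].
Definition ga_mulr (c : gT) (F : grp_alg) : grp_alg :=
  [ffun y => F (y * c^-1)%g].
Definition ga_mull (c : gT) (F : grp_alg) : grp_alg :=
  [ffun y => F (c^-1 * y)%g].

Variables (V : vectType k) (ydV : yd_module gT V).
Variables (R : falgType k) (B : nichols_algebra ydV R).
Variables (H : falgType k) (hH : hopf_algebra H).
Variable bH : bosonization (na_hopf B) hH.
Variables (D : falgType k) (dD : drinfeld_double hH D).

Let Dge0 : {aspace D} :=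
  agenv_aspace (dbl_DG bH dD + dbl_vbar_space bH dD)%VS.

(* [M] is the module M(g, rho) over the subalgebra [dbl_ge0]: the tensor
   product of the group algebra and U over the group algebra of the
   centralizer of g, with V^* acting by zero. *)
Record weight_module (g : gT) (U : vectType k)
    (rho : subg_of 'C[g]%G -> 'End(U)) (M : vectType k) := WeightModule {
  wm_tensor : grp_alg -> U -> M;
  wm_tensorP :
    is_tensor_over (fun c : subg_of 'C[g]%G => ga_mulr (sgval c))
      (fun c u => rho c u) wm_tensor;
  wm_act : subvs_of Dge0 -> M -> M;
  wm_module : is_module wm_act;
  wm_act_grp : forall a x F u, vsval a = dbl_grp bH dD x ->
    wm_act a (wm_tensor F u) = wm_tensor (ga_mull x F) u;
  wm_act_fun : forall a f x u, vsval a = dbl_fun bH dD f ->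
    wm_act a (wm_tensor (ga_elt x) u) =
    f (x * g * x^-1)%g *: wm_tensor (ga_elt x) u;
  wm_act_vbar : forall a y m, vsval a = dbl_vbar bH dD y -> wm_act a m = 0
}.

(* [W] is the Verma module: D (x) M over [dbl_ge0]. *)
Record verma_module (g : gT) (U : vectType k)
    (rho : subg_of 'C[g]%G -> 'End(U)) (M : vectType k)
    (wM : weight_module rho M) (W : vectType k) := VermaModule {
  vm_tensor : D -> M -> W;
  vm_tensorP :
    is_tensor_over (fun (a : subvs_of Dge0) (d : D) => d * vsval a)
      (wm_act wM) vm_tensor;
  vm_act : D -> W -> W;
  vm_module : is_module vm_act;
  vm_actE : forall d d' m, vm_act d (vm_tensor d' m) = vm_tensor (d * d') m
}.

(* The subspace B^n(V) (x) M of the Verma module. *)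
Definition verma_component (g : gT) (U : vectType k)
    (rho : subg_of 'C[g]%G -> 'End(U)) (M : vectType k)
    (wM : weight_module rho M) (W : vectType k) (vW : verma_module wM W)
    (n : nat) : {vspace W} :=
  span_prod (fun r m => vm_tensor vW (dbl_nichols bH dD r) m)
    (limg (na_proj B n)) fullv.

End Verma.

(* Main.v *)
(* As a D(G)-module the Verma module is B(V) (x) M, with V acting by left
   multiplication.  An element of B(V) annihilated by V on the left spans the
   top degree: sent to the bosonization it becomes a left integral, and the
   integrals of a finite-dimensional Hopf algebra form a line.  Hence a vector
   of the Verma module killed by V lies in L (x) M, where L spans the top
   degree of B(V).  Every nonzero submodule contains such a vector, because V
   acts nilpotently, and therefore all of L (x) M, because multiplication by L
   only twists the action of D(G) and M is a simple D(G)-module.  It remains to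
   see that B(Vbar) (L (x) M) is a submodule, whence it is the smallest nonzero
   one.  The primitive elements of B(V) have degree 1, so the dual of the
   bosonization is generated by Vbar = V^* and the functions on G; the functions
   preserve L (x) M, thus the span equals H^* (L (x) M), and it is stable under
   G and V by the commutation relations of the double. *)

(* That the top degree of B(V) is a line comes out of the formula x = phi(x) S(L), where L is a
   right integral of the bosonization, phi an integral of its dual with phi(L) = 1, and x any left
   integral. Such L and phi are written down explicitly from a top degree element homogeneous for
   the coaction; S(L), for which no formula is at hand, is eliminated by putting a known left
   integral for x. The detour through all of H^* has this reason: moving an element of V past a
   functional f replaces f by translates z -> f(x z y). A translate of an element of B(Vbar) may
   involve nonconstant functions on G and so leave B(Vbar), whereas H^* is closed under translation.
   The modules M(g, rho) and M = D (x) M(g, rho) are given by universal properties only. Spanning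
   statements therefore come from the uniqueness of induced maps, and nonvanishing and injectivity
   from maps constructed out of the tensor product. *)
Require Import Defs.
From HB Require Import structures.
From mathcomp Require Import all_boot all_order all_fingroup all_algebra.
From mathcomp Require Import all_field.

Set Implicit Arguments.
Unset Strict Implicit.
Unset Printing Implicit Defensive.

Import GRing.Theory.
Local Open Scope ring_scope.

(** * Linearity of unbundled functions, and a tactic that proves it *)

Section Linear.
Variable k : fieldType.
Implicit Types U V W X : vectType k.

Lemma lin_id U : linear (fun u : U => u). Proof. by []. Qed.

Lemma lin_hom U V W (f : 'Hom(V, W)) (g : U -> V) :
  linear g -> linear (fun u => f (g u)).
Proof. by move=> lg a u v; rewrite lg linearP. Qed.

Lemma lin_app U V W (g : U -> 'Hom(V, W)) (v : V) :
  linear g -> linear (fun u => g u v).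
Proof. by move=> lg a x y; rewrite lg lfunE /= lfunE. Qed.

Lemma lin_coord U V n (X : n.-tuple V) i (g : U -> V) :
  linear g -> linear (fun u => coord X i (g u) : k^o).
Proof. by move=> lg a u v; rewrite lg linearP. Qed.

Lemma lin_mull U (A : falgType k) (g : U -> A) c :
  linear g -> linear (fun u => g u * c).
Proof. by move=> lg a u v; rewrite lg mulrDl scalerAl. Qed.

Lemma lin_mulr U (A : falgType k) (g : U -> A) c :
  linear g -> linear (fun u => c * g u).
Proof. by move=> lg a u v; rewrite lg mulrDr scalerAr. Qed.

Lemma lin_smull U (g : U -> k^o) (c : k) :
  linear g -> linear (fun u => (g u * c : k^o)).
Proof. by move=> lg a u v; rewrite lg mulrDl -mulrA. Qed.

Lemma lin_smulr U (g : U -> k^o) (c : k) :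
  linear g -> linear (fun u => (c * g u : k^o)).
Proof. by move=> lg a u v; rewrite lg mulrDr mulrCA. Qed.

Lemma lin_scalel U W (g : U -> k^o) (w : W) :
  linear g -> linear (fun u => g u *: w).
Proof. by move=> lg a u v; rewrite lg scalerDl -scalerA. Qed.

Lemma lin_scaler U W (g : U -> W) (c : k) :
  linear g -> linear (fun u => c *: g u).
Proof. by move=> lg a u v; rewrite lg scalerDr !scalerA mulrC. Qed.

Lemma lin_sum U W I (r : seq I) (P : pred I) (g : I -> U -> W) :
  (forall i, linear (g i)) -> linear (fun u => \sum_(i <- r | P i) g i u).
Proof.
move=> lg a u v; rewrite scaler_sumr -big_split.
by apply: eq_bigr => i _; rewrite lg.
Qed.

Lemma lin_0 U W : linear (fun u : U => 0 : W).
Proof. by move=> a u v; rewrite scaler0 addr0. Qed.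

Lemma lin_pure1 X U V (g : X -> U) (v : V) :
  linear g -> linear (fun x => pure (g x) v).
Proof.
move=> lg a x y; apply/matrixP=> i j.
by rewrite !mxE lg linearP mulrDl mulrA.
Qed.

Lemma lin_pure2 X U V (g : X -> V) (u : U) :
  linear g -> linear (fun x => pure u (g x)).
Proof.
move=> lg a x y; apply/matrixP=> i j.
by rewrite !mxE lg linearP mulrDr mulrCA.
Qed.

Lemma lin_tlift1 X U V W (g : X -> tens U V) (b : U -> V -> W) :
  linear g -> linear (fun x => tlift (g x) b).
Proof.
move=> lg a x y; rewrite /tlift scaler_sumr -big_split; apply: eq_bigr => i _.
rewrite scaler_sumr -big_split; apply: eq_bigr => j _.
by rewrite lg !mxE scalerDl scalerA.
Qed.

Lemma lin_tlift2 X U V W (T : tens U V) (b : X -> U -> V -> W) :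
  (forall u v, linear (fun x => b x u v)) -> linear (fun x => tlift T (b x)).
Proof.
move=> lb; rewrite /tlift.
by do 2![apply: lin_sum => ?]; apply: lin_scaler; apply: lb.
Qed.

Lemma linear0E U W (f : U -> W) : linear f -> f 0 = 0.
Proof. by move=> lf; move: (lf (-1) 0 0); rewrite !scaleN1r !addNr. Qed.

Lemma linear_sumE U W (f : U -> W) (I : Type) (r : seq I) P (F : I -> U) :
  linear f -> f (\sum_(i <- r | P i) F i) = \sum_(i <- r | P i) f (F i).
Proof.
move=> lf; elim/big_rec2: _ => [|i x y _ <-]; first exact: linear0E.
by rewrite -[F i]scale1r lf !scale1r.
Qed.

Lemma linearZE U W (f : U -> W) a u : linear f -> f (a *: u) = a *: f u.
Proof. by move=> lf; rewrite -[a *: u]addr0 lf linear0E // addr0. Qed.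

(** [lfunE] asks for a bundled linear function; bundling on the spot lets [linfun] be evaluated on
    any function that comes with a proof of linearity. *)
Lemma linfunE U W (f : U -> W) u : linear f -> linfun f u = f u.
Proof.
move=> lf.
pose F : {linear U -> W} := HB.pack f (GRing.isLinear.Build k U W *:%R f lf).
exact: (lfunE F).
Qed.

End Linear.

(* Redefined below, when further linear operations are available. *)
Ltac lin_hook := fail.

Ltac lin :=
  cbv beta;
  lazymatch goal with
  | |- bilinear_map _ => split=> ?; lin
  | |- forall _, _ => move=> ?; lin
  | |- GRing.linear_for _ (fun u => u) => exact: lin_id
  | |- _ => first
      [ by [] | exact: linearP | exact: lin_0
      | apply: lin_hom; lin | apply: lin_app; lin
      | apply: lin_mull; lin | apply: lin_mulr; lin
      | apply: lin_pure1; lin | apply: lin_pure2; lin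
      | apply: lin_tlift1; lin | apply: lin_tlift2; lin
      | apply: lin_scalel; lin | apply: lin_scaler; lin
      | apply: lin_coord; lin | apply: lin_smull; lin | apply: lin_smulr; lin
      | apply: lin_sum; lin | lin_hook; lin ]
  end.

(** * Sweedler calculus *)

Section Tensors.
Variable k : fieldType.
Implicit Types U V W X : vectType k.

Lemma tlift_pure U V W (b : U -> V -> W) u v :
  bilinear_map b -> tlift (pure u v) b = b u v.
Proof.
case=> lb1 lb2.
rewrite {2}(coord_vbasis (memvf u)) {2}(coord_vbasis (memvf v)).
rewrite (linear_sumE _ _ _ (lb2 _)); apply: eq_bigr => i _.
rewrite (linear_sumE _ _ _ (lb1 _)); apply: eq_bigr => j _.
by rewrite mxE (linearZE _ _ (lb1 _)) (linearZE _ _ (lb2 _)) scalerA mulrC.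
Qed.

Lemma tliftD U V W (T T' : tens U V) (b : U -> V -> W) :
  tlift (T + T') b = tlift T b + tlift T' b.
Proof.
have /(_ 1 T T') := lin_tlift1 b (@lin_id _ (tens U V)).
by rewrite !scale1r.
Qed.

Lemma tlift0 U V W (b : U -> V -> W) : tlift 0 b = 0.
Proof. exact: (linear0E (lin_tlift1 b (@lin_id _ (tens U V)))). Qed.

Lemma tlift_sum U V W I (r : seq I) P (T : I -> tens U V) (b : U -> V -> W) :
  tlift (\sum_(i <- r | P i) T i) b = \sum_(i <- r | P i) tlift (T i) b.
Proof. exact: (linear_sumE _ _ _ (lin_tlift1 b (@lin_id _ (tens U V)))). Qed.

Lemma lin_of_tlift U V W X (T : tens U V) (b : U -> V -> W) (f : W -> X) :
  linear f -> f (tlift T b) = \sw_(u, v <- T) f (b u v).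
Proof.
move=> lf; rewrite /tlift (linear_sumE _ _ _ lf); apply: eq_bigr => i _.
rewrite (linear_sumE _ _ _ lf); apply: eq_bigr => j _.
exact: linearZE.
Qed.

Lemma eq_tlift U V W (T : tens U V) (b b' : U -> V -> W) :
  (forall u v, b u v = b' u v) -> tlift T b = tlift T b'.
Proof.
move=> bb'; rewrite /tlift.
by do 2![apply: eq_bigr => ? _]; rewrite bb'.
Qed.

Lemma tlift_pairE U V W (T : tens U V) (b : U -> V -> W) :
  tlift T b = \sum_p T p.1 p.2 *: b (vbasis {:U})`_p.1 (vbasis {:V})`_p.2.
Proof. by rewrite /tlift pair_bigA. Qed.

Lemma tlift_sumr U V W I (r : seq I) P (T : tens U V) (b : I -> U -> V -> W) :
  \sw_(u, v <- T) \sum_(i <- r | P i) b i u v =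
  \sum_(i <- r | P i) tlift T (b i).
Proof.
rewrite tlift_pairE; under eq_bigr => p _ do rewrite scaler_sumr.
rewrite exchange_big; apply: eq_bigr => i _ /=.
by rewrite tlift_pairE.
Qed.

Lemma tlift_eq0 U V W (T : tens U V) (b : U -> V -> W) :
  (forall u v, b u v = 0) -> tlift T b = 0.
Proof. by move=> b0; rewrite tlift_pairE big1 // => p _;
  rewrite b0 scaler0. Qed.

Lemma exchange_tlift U V U' V' W (T : tens U V) (T' : tens U' V')
    (F : U -> V -> U' -> V' -> W) :
  \sw_(a, b <- T) \sw_(c, d <- T') F a b c d =
  \sw_(c, d <- T') \sw_(a, b <- T) F a b c d.
Proof.
rewrite !tlift_pairE.
under eq_bigr => p _ do rewrite tlift_pairE scaler_sumr.
rewrite exchange_big; apply: eq_bigr => q _ /=.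
rewrite tlift_pairE scaler_sumr; apply: eq_bigr => p _.
by rewrite !scalerA mulrC.
Qed.

(** Contracting one factor turns an equation of tensors into equations of vectors. The coordinate
    functionals already recover every matrix entry. *)
Lemma tens_eq U V (T T' : tens U V) :
  (forall xi : dual U, \sw_(u, v <- T) (xi u *: v) = \sw_(u, v <- T') (xi u *:
    v)) ->
  T = T'.
Proof.
move=> eqT; apply/matrixP=> i j.
have coordT (T0 : tens U V) :
    T0 i j = coord (vbasis {:V}) j (\sw_(u, v <- T0) (coord (vbasis {:U}) i u *:
      v)).
  rewrite /tlift (bigD1 i) //= [X in _ + X]big1 ?addr0 => [|i' neq]; last first.
    rewrite big1 // => j' _; rewrite (coord_free _ _ (basis_free (vbasisP _))).
    by rewrite (negPf neq) scale0r scaler0.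
  rewrite linear_sum (bigD1 j) //= big1 ?addr0 => [|j' neq]; last first.
    rewrite !linearZ /= [X in _ * (_ * X)](coord_free _ _ (basis_free (vbasisP
      _))).
    by rewrite (negPf neq) !mulr0.
  rewrite !linearZ /= !(coord_free _ _ (basis_free (vbasisP _))) !eqxx.
  by rewrite !mulr1.
pose xi : dual U := linfun (coord (vbasis {:U}) i : U -> k^o).
have xiE u : xi u = coord (vbasis {:U}) i u.
  by rewrite /xi linfunE // => a v w; rewrite linearP.
have e := congr1 (coord (vbasis {:V}) j) (eqT xi).
rewrite !coordT -(eq_tlift T (b := fun u v => xi u *: v)) => [|u v]; last first.
  by rewrite xiE.
by rewrite e; congr (coord _ j _); apply: eq_tlift => u v; rewrite xiE.
Qed.


Lemma dual_separates W (w : W) : w != 0 ->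
  exists lam : dual W, lam w = 1.
Proof.
move=> w_neq0; have [i wi|w0] := pickP (fun i => coord (vbasis {:W}) i w != 0).
  exists (linfun (fun z => (coord (vbasis {:W}) i w)^-1 * coord (vbasis {:W}) i
    z : k^o)).
  by rewrite linfunE; [exact: mulVf | lin].
case/eqP: w_neq0; rewrite (coord_vbasis (memvf w)) big1 // => i _.
by move/negbFE/eqP: (w0 i) => ->; rewrite scale0r.
Qed.

Lemma dual_ext W (w w' : W) : (forall xi : dual W, xi w = xi w') -> w = w'.
Proof.
move=> e; apply/eqP; rewrite -subr_eq0; apply: contraT => /dual_separates[xi].
by rewrite linearB /= e subrr => /eqP; rewrite eq_sym oner_eq0.
Qed.

Lemma tens_eqr U V (T T' : tens U V) :
    (forall eta : dual V,
      \sw_(u, v <- T) (eta v *: u) = \sw_(u, v <- T') (eta v *: u)) ->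
  T = T'.
Proof.
move=> e; apply: tens_eq => xi; apply: dual_ext => eta.
have swapE (T0 : tens U V) :
    eta (\sw_(u, v <- T0) (xi u *: v)) = xi (\sw_(u, v <- T0) (eta v *: u)).
  rewrite (lin_of_tlift _ _ (f := fun z => eta z)); last by lin.
  rewrite (lin_of_tlift _ _ (f := fun z => xi z)); last by lin.
  by apply: eq_tlift => u v; rewrite !linearZ; apply: mulrC.
by rewrite !swapE e.
Qed.

Lemma tlift_tlift U V U' V' W (T : tens U V) (b : U -> V -> tens U' V')
    (c : U' -> V' -> W) :
  tlift (tlift T b) c = \sw_(u, v <- T) tlift (b u v) c.
Proof. exact: (lin_of_tlift _ _ (lin_tlift1 c (@lin_id _ (tens U' V')))). Qed.

Lemma tlift_id U V (T : tens U V) : tlift T (@pure k U V) = T.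
Proof.
apply: tens_eq => xi; rewrite tlift_tlift; apply: eq_tlift => u v.
by rewrite tlift_pure //; lin.
Qed.

(** Being trilinear, [F] factors through a linear map [L] on the triple tensor product, and [L] is
    applied to both sides of coassociativity. The comultiplication stays abstract to cover Hopf
    algebras and braided ones alike. *)
Lemma coassoc_tlift U W (cm : 'Hom(U, tens U U)) x (F : U -> U -> U -> W) :
    \sw_(a, b <- cm x) pure (cm a) b =
      \sw_(a, b <- cm x) \sw_(c, d <- cm b) pure (pure a c) d ->
    (forall a b, linear (F a b)) -> (forall a c, linear (fun b => F a b c)) ->
    (forall b c, linear (fun a => F a b c)) ->
  \sw_(a, b <- cm x) \sw_(c, d <- cm a) F c d b =
  \sw_(a, b <- cm x) \sw_(c, d <- cm b) F a c d.
Proof.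
move=> coa l3 l2 l1.
pose L (T : tens (tens U U) U) := \sw_(P, b <- T) \sw_(c, d <- P) F c d b.
have lL : linear L by rewrite /L; lin.
have bP P b : L (pure P b) = \sw_(c, d <- P) F c d b.
  by rewrite /L tlift_pure //; lin.
transitivity (L (\sw_(a, b <- cm x) pure (cm a) b)).
  by rewrite (lin_of_tlift _ _ lL); apply: eq_tlift => a b; rewrite bP.
rewrite coa (lin_of_tlift _ _ lL); apply: eq_tlift => a b.
rewrite (lin_of_tlift _ _ lL); apply: eq_tlift => c d.
by rewrite bP tlift_pure.
Qed.

End Tensors.

(** * Integrals of Hopf algebras *)

Section HopfIntegrals.
Variables (k : fieldType) (H : falgType k) (hH : hopf_algebra H).
Local Notation Delta := (ha_comul hH).
Local Notation eps := (ha_counit hH).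
Local Notation S := (ha_antipode hH).

(* Both sides are the value of S(L_(1)) phi(L_(2) x): on the one hand
   L_(2) x = eps(L_(2)) x, on the other hand phi(y) 1 = y_(1) phi(y_(2)) for
   y = L_(2) x, and then S(L_(1)) L_(2) cancels. *)
Lemma hopf_integral_antipode (phi : dual H) (L x : H) :
    (forall a, \sw_(a1, a2 <- Delta a) (phi a2 *: a1) = phi a *: 1) ->
    (forall h, L * h = eps h *: L) -> phi L = 1 ->
    (forall h, h * x = eps h *: x) ->
  x = phi x *: S L.
Proof.
move=> phi_int L_int phiL x_int.
have -> : phi x *: S L = \sw_(L1, L2 <- Delta L) (phi (L2 * x) *: S L1).
  rewrite -{1}(ha_counitr hH L) (lin_of_tlift _ _ (f := fun z => phi x *: S z)).
    apply: eq_tlift => L1 L2.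
    by rewrite x_int !linearZ /= scalerA; congr (_ *: _); apply: mulrC.
  by lin.
transitivity (\sw_(L1, L2 <- Delta L) \sw_(c, d <- Delta L2)
    \sw_(x1, x2 <- Delta x) (phi (d * x2) *: (S L1 * c * x1))); last first.
  apply: eq_tlift => L1 L2.
  transitivity (S L1 * (phi (L2 * x) *: 1)); last by rewrite -scalerAr mulr1.
  rewrite -phi_int ha_comulM tlift_tlift.
  rewrite (lin_of_tlift _ _ (f := fun z => S L1 * z)); last by lin.
  apply: eq_tlift => c d; rewrite tlift_tlift.
  rewrite (lin_of_tlift _ _ (f := fun z => S L1 * z)); last by lin.
  apply: eq_tlift => x1 x2.
  rewrite tlift_pure; last by lin.
  by rewrite -scalerAr mulrA.
rewrite -(coassoc_tlift (F := fun a b c => \sw_(x1, x2 <- Delta x)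
  (phi (c * x2) *: (S a * b * x1))) (ha_coassoc hH L)); [|by lin..].
transitivity (\sw_(L1, L2 <- Delta L) \sw_(x1, x2 <- Delta x)
    (eps L1 *: (phi (L2 * x2) *: x1))); last first.
  apply: eq_tlift => L1 L2; rewrite exchange_tlift; apply: eq_tlift => x1 x2.
  transitivity (phi (L2 * x2) *: ((eps L1 *: 1) * x1)).
    by rewrite -scalerAl mul1r !scalerA mulrC.
  rewrite -ha_antipodel (lin_of_tlift _ _
    (f := fun z => phi (L2 * x2) *: (z * x1))) //.
  by lin.
rewrite exchange_tlift -{1}(ha_counitr hH x); apply: eq_tlift => x1 x2.
transitivity (phi (L * x2) *: x1); first by rewrite L_int linearZ /= phiL [_ *:
  1]mulr1.
rewrite -{1}(ha_counitl hH L).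
rewrite (lin_of_tlift _ _ (f := fun z => phi (z * x2) *: x1)); last by lin.
by apply: eq_tlift => L1 L2; rewrite -scalerAl linearZ /= scalerA.
Qed.

End HopfIntegrals.

(** * The Drinfeld double *)

Section DualBasis.
Variables (k : fieldType) (W : vectType k).

Lemma dual_basisE i (x : W) : dual_basis i x = coord (vbasis {:W}) i x.
Proof. by rewrite /dual_basis linfunE //; lin. Qed.

Lemma dual_basis_sum (f : dual W) :
  f = \sum_(i < \dim {:W}) f (vbasis {:W})`_i *: dual_basis i.
Proof.
apply/lfunP=> x; rewrite sum_lfunE {1}(coord_vbasis (memvf x)) linear_sum.
apply: eq_bigr => i _; rewrite !lfunE /= linearZ /= dual_basisE.
exact: mulrC.
Qed.

End DualBasis.

(** * The dual of a Hopf algebra and the translates of a functional *)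

Section HopfDual.
Variables (k : fieldType) (H : falgType k) (hH : hopf_algebra H).
Local Notation Delta := (ha_comul hH).
Local Notation eps := (ha_counit hH).
Local Notation S := (ha_antipode hH).

(** In Sweedler notation this is f_(1)(x) f_(3)(y) f_(2), the combination that occurs in the product
    of the double. *)
Definition two_sided_shift (f : dual H) (x y : H) : dual H :=
  linfun (fun z : H => f (x * z * y) : k^o).

Lemma two_sided_shiftE f x y z : two_sided_shift f x y z = f (x * z * y).
Proof. by rewrite /two_sided_shift linfunE //; lin. Qed.

Lemma lin_shift1 (X : vectType k) (g : X -> dual H) x y :
  linear g -> linear (fun u => two_sided_shift (g u) x y).
Proof.
move=> lg a u v; apply/lfunP=> z.
by rewrite lg add_lfunE scale_lfunE !two_sided_shiftE add_lfunE scale_lfunE.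
Qed.

Lemma lin_shift2 (X : vectType k) (g : X -> H) f y :
  linear g -> linear (fun u => two_sided_shift f (g u) y).
Proof.
move=> lg a u v; apply/lfunP=> z.
rewrite add_lfunE scale_lfunE !two_sided_shiftE lg.
by rewrite !mulrDl -!scalerAl linearP.
Qed.

Lemma lin_shift3 (X : vectType k) (g : X -> H) f x :
  linear g -> linear (fun u => two_sided_shift f x (g u)).
Proof.
move=> lg a u v; apply/lfunP=> z.
rewrite add_lfunE scale_lfunE !two_sided_shiftE lg.
by rewrite !mulrDr -!scalerAr linearP.
Qed.

Lemma dual_mulE (f f' : dual H) x :
  dual_mul hH f f' x = \sw_(a, b <- Delta x) (f a * f' b : k^o).
Proof. by rewrite /dual_mul linfunE //; lin. Qed.

Lemma lin_dual_mull (X : vectType k) (g : X -> dual H) f :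
  linear g -> linear (fun u => dual_mul hH (g u) f).
Proof.
move=> lg a u v; apply/lfunP=> x; rewrite add_lfunE scale_lfunE !dual_mulE.
have lT : linear (fun f' : dual H => \sw_(a, b <- Delta x) (f' a * f b : k^o)).
  by lin.
by rewrite lg lT.
Qed.

Lemma lin_dual_mulr (X : vectType k) (g : X -> dual H) f :
  linear g -> linear (fun u => dual_mul hH f (g u)).
Proof.
move=> lg a u v; apply/lfunP=> x; rewrite add_lfunE scale_lfunE !dual_mulE.
have lT : linear (fun f' : dual H => \sw_(a, b <- Delta x) (f a * f' b : k^o)).
  by lin.
by rewrite lg lT.
Qed.

Lemma shift11 f : two_sided_shift f 1 1 = f.
Proof. by apply/lfunP=> z; rewrite two_sided_shiftE mulr1 mul1r. Qed.

Lemma shift_counit x y : two_sided_shift eps x y = (eps x * eps y) *: eps.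
Proof.
apply/lfunP=> z; rewrite two_sided_shiftE !ha_counitM scale_lfunE.
by rewrite /GRing.scale /= -!mulrA; congr (_ * _); apply: mulrC.
Qed.

Lemma dual_mul1l f : dual_mul hH eps f = f.
Proof.
apply/lfunP=> x; rewrite dual_mulE -{2}(ha_counitl hH x).
rewrite (lin_of_tlift _ _ (f := fun z => f z)); last by lin.
by apply: eq_tlift => a b; rewrite linearZ.
Qed.

Lemma dual_mul1r f : dual_mul hH f eps = f.
Proof.
apply/lfunP=> x; rewrite dual_mulE -{2}(ha_counitr hH x).
rewrite (lin_of_tlift _ _ (f := fun z => f z)); last by lin.
by apply: eq_tlift => a b; rewrite linearZ; apply: mulrC.
Qed.

Lemma counit_antipode x : eps (S x) = eps x.
Proof.
rewrite -{1}(ha_counitr hH x).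
rewrite (lin_of_tlift _ _ (f := fun z => eps (S z))); last by lin.
transitivity (eps (eps x *: 1)); last first.
  by rewrite linearZ /= ha_counit1 [_ *: 1]mulr1.
rewrite -ha_antipodel (lin_of_tlift _ _ (f := fun z => eps z)); last by lin.
apply: eq_tlift => a b; rewrite ha_counitM !linearZ.
exact: mulrC.
Qed.

Lemma antipode1 : S 1 = 1.
Proof.
have := ha_antipodel hH 1; rewrite ha_comul1 tlift_pure; last by lin.
by rewrite mulr1 ha_counit1 scale1r.
Qed.

Lemma dual_comul_tlift (W : vectType k) f (G : dual H -> dual H -> W) :
    bilinear_map G ->
  \sw_(f1, f2 <- dual_comul f) G f1 f2 =
  \sum_(i < \dim {:H}) \sum_(j < \dim {:H})
    f ((vbasis {:H})`_i * (vbasis {:H})`_j) *: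
    G (dual_basis i) (dual_basis j).
Proof.
move=> bG; rewrite /dual_comul tlift_sum; apply: eq_bigr => i _.
rewrite tlift_sum; apply: eq_bigr => j _.
rewrite (linearZE _ _ (lin_tlift1 G (@lin_id _ (tens (dual H) (dual H))))).
by rewrite tlift_pure.
Qed.

Lemma dual_comul_evall (f : dual H) x :
  \sw_(f1, f2 <- dual_comul f) (f1 x *: f2) = two_sided_shift f x 1.
Proof.
rewrite dual_comul_tlift.
  apply/lfunP=> z; rewrite sum_lfunE two_sided_shiftE mulr1.
  rewrite {2}(coord_vbasis (memvf x)) {2}(coord_vbasis (memvf z)).
  rewrite mulr_suml linear_sum; apply: eq_bigr => i _.
  rewrite mulr_sumr linear_sum sum_lfunE; apply: eq_bigr => j _.
  rewrite -scalerAl -scalerAr !linearZ /= !lfunE /= !lfunE /= !dual_basisE.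
  by congr (_ *: _); apply: mulrC.
by lin.
Qed.

Lemma dual_comul_evalr (f : dual H) y :
  \sw_(f1, f2 <- dual_comul f) (f2 y *: f1) = two_sided_shift f 1 y.
Proof.
rewrite dual_comul_tlift.
  apply/lfunP=> z; rewrite sum_lfunE two_sided_shiftE mul1r.
  rewrite {2}(coord_vbasis (memvf z)) {2}(coord_vbasis (memvf y)).
  rewrite mulr_suml linear_sum; apply: eq_bigr => i _.
  rewrite mulr_sumr linear_sum sum_lfunE; apply: eq_bigr => j _.
  rewrite -scalerAl -scalerAr !linearZ /= !lfunE /= !lfunE /= !dual_basisE.
  by rewrite /GRing.scale /= [RHS]mulrCA; congr (_ * _); apply: mulrC.
by lin.
Qed.

End HopfDual.

Ltac lin_hook ::= first
  [ apply: lin_shift1 | apply: lin_shift2 | apply: lin_shift3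
  | apply: lin_dual_mull | apply: lin_dual_mulr ].

(** * Commutation relations in the double of a Hopf algebra *)

Section Double.
Variables (k : fieldType) (H : falgType k) (hH : hopf_algebra H).
Variables (D : falgType k) (dD : drinfeld_double hH D).
Local Notation Delta := (ha_comul hH).
Local Notation eps := (ha_counit hH).
Local Notation S := (ha_antipode hH).

Definition dbl_hopf (h : H) : D := dd_elt dD (pure h eps).
Definition dbl_dual (f : dual H) : D := dd_elt dD (pure 1 f).

Lemma lin_dbl_hopf : linear dbl_hopf. Proof. by rewrite /dbl_hopf; lin. Qed.
Lemma lin_dbl_dual : linear dbl_dual. Proof. by rewrite /dbl_dual; lin. Qed.

(** The three Sweedler legs of [f] are absorbed into one translate, so that only the
    comultiplication of [h'] remains to be expanded. *)
Lemma dd_mulE h f h' f' :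
  dd_elt dD (pure h f) * dd_elt dD (pure h' f') =
  \sw_(h1, h23 <- Delta h') \sw_(h2, h3 <- Delta h23)
    dd_elt dD (pure (h * h2) (dual_mul hH f' (two_sided_shift f h1 (S h3)))).
Proof.
rewrite dd_mul.
under eq_tlift => f1 f23.
  rewrite exchange_tlift.
  under eq_tlift => h1 h23 do rewrite exchange_tlift.
  over.
rewrite exchange_tlift; apply: eq_tlift => h1 h23.
rewrite exchange_tlift; apply: eq_tlift => h2 h3.
pose G f2 := dd_elt dD (pure (h * h2) (dual_mul hH f' f2)).
have lG : linear G by rewrite /G; lin.
have -> : two_sided_shift f h1 (S h3) =
    two_sided_shift (two_sided_shift f h1 1) 1 (S h3).
  by apply/lfunP=> z; rewrite !two_sided_shiftE mul1r mulr1 mulrA.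
rewrite -dual_comul_evall -/(G _).
rewrite (lin_of_tlift _ _ (f := fun f0 => G (two_sided_shift f0 1 (S h3)))).
  apply: eq_tlift => f1 f23.
  rewrite (linearZE (f := fun f0 => G (two_sided_shift f0 1 (S h3))));
    last by rewrite /G; lin.
  have -> : G (two_sided_shift f23 1 (S h3)) =
      \sw_(f2, f3 <- dual_comul f23) (f3 (S h3) *: G f2).
    rewrite -dual_comul_evalr (lin_of_tlift _ _ lG).
    by apply: eq_tlift => f2 f3; apply: linearZE.
  rewrite (lin_of_tlift _ _ (f := fun z : D => f1 h1 *: z)); last by lin.
  by apply: eq_tlift => f2 f3; rewrite scalerA.
by rewrite /G; lin.
Qed.

Lemma dd_mul_hopf h h' f' :
  dbl_hopf h * dd_elt dD (pure h' f') = dd_elt dD (pure (h * h') f').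
Proof.
rewrite dd_mulE.
pose G z := dd_elt dD (pure (h * z) f').
have lG : linear G by rewrite /G; lin.
rewrite -/(G h') -{2}(ha_counitl hH h') (lin_of_tlift _ _ lG).
apply: eq_tlift => h1 h23; rewrite (linearZE _ _ lG).
rewrite -{2}(ha_counitr hH h23) (lin_of_tlift _ _ lG).
rewrite (lin_of_tlift _ _ (f := fun z : D => eps h1 *: z)); last by lin.
apply: eq_tlift => h2 h3; rewrite (linearZE _ _ lG) scalerA.
rewrite shift_counit counit_antipode.
rewrite (linearZE (f := fun e => dd_elt dD (pure (h * h2) (dual_mul hH f' e)))).
  by rewrite dual_mul1r.
by lin.
Qed.

Lemma dbl_hopf_dual h f : dbl_hopf h * dbl_dual f = dd_elt dD (pure h f).
Proof. by rewrite dd_mul_hopf mulr1. Qed.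

Lemma dbl_hopfM h h' : dbl_hopf (h * h') = dbl_hopf h * dbl_hopf h'.
Proof. by rewrite [RHS]dd_mul_hopf. Qed.

Lemma dd_mul_dual h f f' :
  dd_elt dD (pure h f) * dbl_dual f' = dd_elt dD (pure h (dual_mul hH f' f)).
Proof.
rewrite dd_mulE ha_comul1 tlift_pure; last by lin.
by rewrite ha_comul1 tlift_pure ?antipode1 ?shift11 ?mulr1 //; lin.
Qed.

(** The order is reversed because the double contains the opposite algebra of the dual. *)
Lemma dbl_dualM f f' : dbl_dual (dual_mul hH f' f) = dbl_dual f * dbl_dual f'.
Proof. by rewrite dd_mul_dual. Qed.

Lemma dbl_hopf1 : dbl_hopf 1 = 1. Proof. exact: dd_one. Qed.
Lemma dbl_dual1 : dbl_dual eps = 1. Proof. exact: dd_one. Qed.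

Lemma dbl_dual_hopf f h :
  dbl_dual f * dbl_hopf h =
  \sw_(h1, h23 <- Delta h) \sw_(h2, h3 <- Delta h23)
    (dbl_hopf h2 * dbl_dual (two_sided_shift f h1 (S h3))).
Proof.
rewrite dd_mulE; do 2![apply: eq_tlift => ? ?].
by rewrite mul1r dual_mul1l dbl_hopf_dual.
Qed.

Lemma dbl_span d (X : {vspace D}) :
  (forall h f, dbl_hopf h * dbl_dual f \in X) -> d \in X.
Proof.
move=> hX; have [e _ eK] := dd_bij dD.
rewrite -[d]eK -[e d]tlift_id linear_sum /=; apply: memv_suml => i _.
rewrite linear_sum; apply: memv_suml => j _.
by rewrite linearZ memvZ //= -dbl_hopf_dual.
Qed.

End Double.

(** * Nichols algebras *)

Section Nichols.
Variables (k : fieldType) (gT : finGroupType).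
Variables (V : vectType k) (ydV : yd_module gT V).
Variables (R : falgType k) (B : nichols_algebra ydV R).
Local Notation Delta := (bh_comul (na_hopf B)).
Local Notation eps := (bh_counit (na_hopf B)).
Local Notation pr := (na_proj B).

Lemma na_proj_ext x y : (forall m, pr m x = pr m y) -> x = y.
Proof.
move=> e; have [N sumN] := na_proj_sum B.
by rewrite -(sumN x) -(sumN y); apply: eq_bigr => m _.
Qed.

Lemma na_proj_id n x : x \in limg (pr n) -> pr n x = x.
Proof. by case/memv_imgP=> y _ ->; rewrite na_projK eqxx. Qed.

Lemma na_counit_proj0 x : eps (pr 0 x) = eps x.
Proof.
have [N sumN] := na_proj_sum B; rewrite -{2}(sumN x) linear_sum /=.
case: N sumN => [|N] sumN.
  by rewrite big_ord0 -[x](sumN x) big_ord0 !linear0.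
rewrite big_ord_recl /= big1 ?addr0 // => i _.
exact: na_proj_counit.
Qed.

Lemma na_proj0E x : pr 0 x = eps x *: 1.
Proof.
have: pr 0 x \in 1%VS by rewrite -(na_degree0 B) memv_img ?memvf.
case/vlineP=> c e; rewrite -na_counit_proj0 e linearZ /= bh_counit1.
by congr (_ *: _); symmetry; apply: mulr1.
Qed.

Lemma na_proj1E m : pr m 1 = (m == 0)%:R.
Proof.
have e : pr 0 1 = 1 by rewrite na_proj0E bh_counit1 scale1r.
by rewrite -{1}e na_projK; case: eqP => // ->.
Qed.

Lemma na_proj_large : exists2 N,
  forall x, \sum_(n < N) pr n x = x & forall m x, (N <= m)%N -> pr m x = 0.
Proof.
have [N sumN] := na_proj_sum B; exists N => // m x leNm.
rewrite -{1}[x]sumN linear_sum big1 // => i _.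
by rewrite /= na_projK gtn_eqF // (leq_trans (ltn_ord i)).
Qed.

(** The grading axiom only says that components of the wrong total degree vanish. Splitting [x] into
    homogeneous parts shows that the component of the right total degree can be read off from [x]
    itself. *)
Lemma tlift_proj (W : vectType k) (F : R -> R -> W) i j n x :
    bilinear_map F ->
  \sw_(a, b <- Delta (pr n x)) F (pr i a) (pr j b) =
  if (i + j)%N == n then \sw_(a, b <- Delta x) F (pr i a) (pr j b) else 0.
Proof.
case=> lF1 lF2; pose G z := \sw_(a, b <- Delta z) F (pr i a) (pr j b).
have lG : linear G by apply: lin_tlift1; lin.
have zero m y : (i + j)%N != m -> G (pr m y) = 0.
  move=> neq; have /(congr1 (fun T => tlift T F)) := na_proj_comul B y neq.
  rewrite tlift0 tlift_tlift => <-; apply: eq_tlift => a b.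
  by rewrite tlift_pure.
rewrite -!/(G _); case: eqP => [<-|/eqP neq]; last exact: zero.
have [N sumN largeN] := na_proj_large.
rewrite -{2}(sumN x) (linear_sumE _ _ _ lG).
case: (ltnP (i + j) N) => ltN.
  rewrite (bigD1 (Ordinal ltN)) //= big1 ?addr0 // => m neq.
  by apply: zero; rewrite eq_sym.
rewrite largeN // (linear0E lG) big1 // => m _; apply: zero.
by rewrite gtn_eqF // (leq_trans (ltn_ord m)).
Qed.

Lemma tlift_projr (W : vectType k) (F : R -> R -> W) n j x :
    bilinear_map F ->
  \sw_(a, b <- Delta (pr n x)) F a (pr j b) =
  if (j <= n)%N then \sw_(a, b <- Delta x) F (pr (n - j) a) (pr j b) else 0.
Proof.
move=> bF; have [lF1 lF2] := bF; have [N sumN largeN] := na_proj_large.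
transitivity (\sum_(i < N) \sw_(a, b <- Delta (pr n x)) F (pr i a) (pr j b)).
  rewrite -tlift_sumr; apply: eq_tlift => a b.
  by rewrite -(linear_sumE _ _ _ (lF2 (pr j b))) sumN.
under eq_bigr => i _ do rewrite tlift_proj //.
case: leqP => [lejn|ltnj]; last first.
  by rewrite big1 // => i _; rewrite gtn_eqF // ltn_addl.
(* The degree [n - j] may lie outside the range of summation; components of such degrees are zero,
   and both sides vanish. *)
case: (ltnP (n - j) N) => ltN.
  rewrite (bigD1 (Ordinal ltN)) //= subnK // eqxx big1 ?addr0 // => m neq.
  case: eqP => // e; case/eqP: neq; apply: val_inj => /=.
  by rewrite -e addnK.
rewrite big1 => [|m _]; last first.
  case: eqP => // e; have := ltn_ord m; rewrite ltnNge.
  by rewrite (leq_trans ltN) // -e addnK.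
by rewrite tlift_eq0 // => a b; rewrite largeN ?(linear0E (lF2 _)).
Qed.

(* By coassociativity and induction all the components of degree (i, n - i),
   0 < i < n, of the comultiplication of x vanish, so that x is primitive. *)
Lemma nichols_coderivation n x : (0 < n)%N -> pr n x = x ->
  \sw_(a, b <- Delta x) pure a (pr 1 b) = 0 -> x = 0.
Proof.
elim/ltn_ind: n x => n IHn x n_gt0 xn x1.
pose y (xi : dual R) j := \sw_(a, b <- Delta x) (xi a *: pr j b).
have yE (xi : dual R) j : pr j (\sw_(a, b <- Delta x) (xi a *: b)) = y xi j.
  rewrite (lin_of_tlift _ _ (f := fun z => pr j z)); last by lin.
  by apply: eq_tlift => a b; rewrite linearZ.
have y0 (xi : dual R) : y xi 0 = xi x *: 1.
  rewrite -{1}(bh_counitr (na_hopf B) x).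
  rewrite (lin_of_tlift _ _ (f := fun z => xi z *: (1 : R))); last by lin.
  apply: eq_tlift => a b; rewrite na_proj0E scalerA linearZ.
  by congr (_ *: _); apply: mulrC.
have yn (xi : dual R) : y xi n = xi 1 *: x.
  rewrite /y -{1}xn (tlift_projr (F := fun a b => xi a *: b)); last by lin.
  rewrite leqnn subnn -{2}xn -{2}(bh_counitl (na_hopf B) x).
  rewrite (lin_of_tlift _ _ (f := fun z => xi 1 *: pr n z)); last by lin.
  apply: eq_tlift => a b; rewrite na_proj0E !linearZ /= scalerA.
  by congr (_ *: _); apply: mulrC.
have y_gt (xi : dual R) j : (n < j)%N -> y xi j = 0.
  move=> ltnj; rewrite /y -{1}xn (tlift_projr (F := fun a b => xi a *: b)).
    by rewrite leqNgt ltnj.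
  by lin.
have y_lt (xi : dual R) j : (0 < j < n)%N -> y xi j = 0.
  case/andP=> j_gt0 ltjn; apply: (IHn j ltjn _ j_gt0).
    by rewrite -yE na_projK eqxx.
  pose F u v w := xi u *: pure (pr (j - 1) v) (pr 1 w).
  transitivity (\sw_(a, b <- Delta x) \sw_(c, d <- Delta b) F a c d).
    rewrite (lin_of_tlift _ _ (f := fun z =>
      \sw_(a, b <- Delta z) pure a (pr 1 b))).
      apply: eq_tlift => a b; rewrite linearZ /=.
      rewrite (linearZE (f := fun T => tlift T (fun u v => pure u (pr 1 v)))).
        rewrite (tlift_projr (F := fun u v => pure u v)); last by lin.
        rewrite j_gt0 (lin_of_tlift _ _ (f := fun z : tens R R => xi a *:
          z)) //.
        by lin.
      by lin.
    by lin.
  rewrite -(coassoc_tlift (F := F) (bh_coassoc (na_hopf B) x)).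
      pose L (T : tens R R) := \sw_(u, v <- T) \sw_(c, d <- Delta u)
        (xi c *: pure (pr (j - 1) d) v).
      transitivity (L (\sw_(a, b <- Delta x) pure a (pr 1 b))).
        rewrite /L tlift_tlift; apply: eq_tlift => a b.
        by rewrite tlift_pure //; lin.
      by rewrite x1 /L tlift0.
    by rewrite /F; lin.
  by rewrite /F; lin.
  by rewrite /F; lin.
have prim : Delta x = pure x 1 + pure 1 x.
  apply: tens_eq => xi; rewrite tliftD !tlift_pure; [|by lin..].
  apply: na_proj_ext => m; rewrite yE linearD !linearZ /= na_proj1E.
  have -> : pr m x = if m == n then x else 0.
    by rewrite -{1}xn na_projK; case: eqP => // ->.
  case: (posnP m) => [->|m_gt0].
    by rewrite y0 (ltn_eqF n_gt0) scaler0 addr0.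
  rewrite /= scaler0 add0r; case: ltngtP => [ltmn|ltnm|->].
  - by rewrite y_lt ?m_gt0 // scaler0.
  - by rewrite y_gt // scaler0.
  - exact: yn.
have x_1 := na_proj_id (proj1 (na_primitive B x) prim).
(* A primitive element has degree 1, so x = 0 unless [n] is 1. In degree 1 the hypothesis [x1],
   contracted with the counit on the left, says x = 0. *)
have [n1|n1] := eqVneq n 1%N; last by rewrite -xn -x_1 na_projK (negPf n1).
rewrite -x_1 -{1}(bh_counitl (na_hopf B) x) yE /y -(tlift0 (fun a b : R =>
  eps a *: b)).
rewrite -x1 tlift_tlift; apply: eq_tlift => a b.
by rewrite tlift_pure //; lin.
Qed.

Lemma na_inj_proj v : pr 1 (na_inj B v) = na_inj B v.
Proof. by apply: na_proj_id; rewrite -na_inj_img memv_img ?memvf. Qed.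

Lemma na_counit_inj v : eps (na_inj B v) = 0.
Proof. by rewrite -na_inj_proj na_proj_counit. Qed.

Lemma na_indl (X : {vspace R}) :
    1 \in X -> (forall v x, x \in X -> na_inj B v * x \in X) ->
  forall x, x \in X.
Proof.
move=> X1 XM x; have: x \in fullv by apply: memvf.
rewrite -(na_generated B); apply: subvP; apply: agenv_sub_modl.
  by rewrite -memvE.
by rewrite -na_inj_img; apply/prodvP=> _ y /memv_imgP[v _ ->]; apply: XM.
Qed.

Lemma na_indr (X : {vspace R}) :
    1 \in X -> (forall v x, x \in X -> x * na_inj B v \in X) ->
  forall x, x \in X.
Proof.
move=> X1 XM x; have: x \in fullv by apply: memvf.
rewrite -(na_generated B); apply: subvP; apply: agenv_sub_modr.
  by rewrite -memvE.
by rewrite -na_inj_img; apply/prodvP=> y _ yX /memv_imgP[v _ ->]; apply: XM.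
Qed.

Lemma na_left_integral x :
  (forall v, na_inj B v * x = 0) -> forall r, r * x = eps r *: x.
Proof.
move=> x0 r; pose f := linfun (fun r => r * x) - linfun (fun r => eps r *: x).
have fE z : f z = z * x - eps z *: x.
  by rewrite add_lfunE opp_lfunE !linfunE //; lin.
suff: r \in lker f by rewrite memv_ker fE subr_eq0 => /eqP.
apply: na_indl => [|v y]; rewrite !memv_ker !fE ?bh_counit1.
  by rewrite mul1r scale1r subrr.
rewrite subr_eq0 => /eqP e.
by rewrite -mulrA e -scalerAr x0 bh_counitM na_counit_inj mul0r scale0r scaler0
  subrr.
Qed.

Lemma na_right_integral x :
  (forall v, x * na_inj B v = 0) -> forall r, x * r = eps r *: x.
Proof.
move=> x0 r; pose f := linfun (fun r => x * r) - linfun (fun r => eps r *: x).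
have fE z : f z = x * z - eps z *: x.
  by rewrite add_lfunE opp_lfunE !linfunE //; lin.
suff: r \in lker f by rewrite memv_ker fE subr_eq0 => /eqP.
apply: na_indr => [|v y]; rewrite !memv_ker !fE ?bh_counit1.
  by rewrite mulr1 scale1r subrr.
rewrite subr_eq0 => /eqP e.
by rewrite mulrA e -scalerAl x0 bh_counitM na_counit_inj mulr0 scale0r scaler0
  subrr.
Qed.

Section TopDegree.
Variables (n : nat) (top_n : is_top_degree B n).

Lemma na_proj_top m x : (n < m)%N -> pr m x = 0.
Proof.
move=> ltnm; apply/eqP; rewrite -memv0 -(proj2 top_n m ltnm).
by rewrite memv_img ?memvf.
Qed.

Lemma na_top_left x : pr n x = x -> forall r, r * x = eps r *: x.
Proof.
move=> xn; apply: na_left_integral => v.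
by rewrite -na_inj_proj -xn -na_projM na_proj_top.
Qed.

Lemma na_top_right x : pr n x = x -> forall r, x * r = eps r *: x.
Proof.
move=> xn; apply: na_right_integral => v.
by rewrite -na_inj_proj -xn -na_projM addnC na_proj_top.
Qed.

(** The right leg cannot exceed the degree of the element, so only the part of degree [n]
    contributes; its left leg then has degree 0 and is the scalar given by the counit. *)
Lemma tlift_top (W : vectType k) (F : R -> R -> W) r :
    bilinear_map F ->
  \sw_(a, b <- Delta r) F a (pr n b) = F 1 (pr n r).
Proof.
move=> bF; have [lF1 lF2] := bF; have [N sumN largeN] := na_proj_large.
have ltnN : (n < N)%N.
  rewrite ltnNge; apply/negP=> leNn; case: top_n => /eqP/negP[]; rewrite -subv0.
  by apply/subvP=> _ /memv_imgP[x _ ->]; rewrite largeN ?mem0v.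
pose G z := \sw_(a, b <- Delta z) F a (pr n b).
have lG : linear G.
  by apply: lin_tlift1; lin.
rewrite -/(G r) -{1}(sumN r) (linear_sumE _ _ _ lG) (bigD1 (Ordinal ltnN)) //=.
rewrite big1 ?addr0 => [|m neq]; last first.
  have [ltnm|lemn] := ltnP n m; first by rewrite na_proj_top // (linear0E lG).
  rewrite /G (tlift_projr (F := F)) // leqNgt ltn_neqAle lemn andbT.
  by case: (m =P n :> nat) => // e; case/eqP: neq; apply: val_inj.
rewrite /G (tlift_projr (F := F)) // leqnn subnn -{2}(bh_counitl (na_hopf B) r).
rewrite (lin_of_tlift _ _ (f := fun z => F 1 (pr n z))); last first.
  by move=> c y z; rewrite linearP lF1.
apply: eq_tlift => a b; rewrite na_proj0E !linearZ /=.
by rewrite (linearZE _ _ (lF2 _)) (linearZE _ _ (lF1 _)).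
Qed.

End TopDegree.
End Nichols.

(** * Integrals of the bosonization and the top degree of the Nichols algebra *)

Section BosonizationIntegrals.
Variables (k : fieldType) (gT : finGroupType).
Variables (V : vectType k) (ydV : yd_module gT V).
Variables (R : falgType k) (B : nichols_algebra ydV R).
Variables (H : falgType k) (hH : hopf_algebra H).
Variable bH : bosonization (na_hopf B) hH.
Local Notation yd := (bh_yd (na_hopf B)).
Local Notation pr := (na_proj B).
Local Notation bos := (bos_elt bH).

Lemma bos_linear_ext (W : vectType k) (f f' : H -> W) :
    linear f -> linear f' -> (forall g r, f (bos g r) = f' (bos g r)) ->
      f =1 f'.
Proof.
move=> lf lf' e h; rewrite -(bos_coordK bH h) !linear_sumE //.
by apply: eq_bigr => g _.
Qed.

(** The sum is the product of the integral of the group algebra with x, in this order, in normal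
    form; the reverse order gives the right integral of [bos_right_integral]. *)
Lemma bos_left_integral x : (forall r, r * x = bh_counit (na_hopf B) r *: x) ->
  forall h, h * (\sum_g bos g (ydact yd g x)) =
    ha_counit hH h *: (\sum_g bos g (ydact yd g x)).
Proof.
move=> x_int.
apply: bos_linear_ext => [||s r]; [by lin|by lin|].
rewrite mulr_sumr bos_counit scaler_sumr [RHS](reindex_inj (mulgI s)) /=.
apply: eq_bigr => g _; rewrite bos_mul -ydactM -linearZ /=; congr (bos _ _).
rewrite -[r in LHS](_ : ydact yd (s * g)%g (ydact yd (s * g)^-1%g r) = r).
  by rewrite -bh_actM x_int linearZ /= bh_counit_act.
by rewrite -ydactM mulgV ydact1.
Qed.

Lemma bos_right_integral x : (forall r, x * r = bh_counit (na_hopf B) r *: x) ->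
  forall h, (\sum_g bos g x) * h = ha_counit hH h *: (\sum_g bos g x).
Proof.
move=> x_int.
apply: bos_linear_ext => [||s r]; [by lin|by lin|].
rewrite mulr_suml bos_counit scaler_sumr [RHS](reindex_inj (mulIg s)) /=.
by apply: eq_bigr => g _; rewrite bos_mul x_int bh_counit_act linearZ.
Qed.

Lemma bos_comul_tlift (W : vectType k) (F : H -> H -> W) g r :
    bilinear_map F ->
  \sw_(a, b <- ha_comul hH (bos g r)) F a b =
  \sw_(a, b <- bh_comul (na_hopf B) r)
    \sum_t F (bos (t * g)%g a) (bos g (ydpart yd t b)).
Proof.
move=> bF; rewrite bos_comul tlift_tlift; apply: eq_tlift => a b.
by rewrite tlift_sum; apply: eq_bigr => t _; rewrite tlift_pure.
Qed.

Section TopDegree.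
Variables (n : nat) (top_n : is_top_degree B n).

(** In the comultiplication of r # g, a second leg of degree t puts the first leg at the group
    element t g. The choice g = t^-1 makes this 1, and [tlift_top] reduces the first leg to the unit
    of R. *)
Lemma bos_integral_functional (t : gT) (lam : dual R) (phi : dual H) :
    (forall g r, phi (bos g r) =
      if g == t^-1%g then lam (ydpart yd t (pr n r)) else 0) ->
  forall a, \sw_(a1, a2 <- ha_comul hH a) (phi a2 *: a1) = phi a *: 1.
Proof.
move=> phiE; apply: bos_linear_ext => [||g r]; [by lin|by lin|].
rewrite (bos_comul_tlift (F := fun a1 a2 => phi a2 *: a1)); last by lin.
under eq_tlift => a b do under eq_bigr => s _ do rewrite phiE.
rewrite phiE; case: eqP => [->|_]; last first.
  by rewrite scale0r tlift_eq0 // => a b; rewrite big1 // => s _;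
    rewrite scale0r.
rewrite -(bos_one bH).
rewrite -(tlift_top top_n (F := fun a b => lam (ydpart yd t b) *: bos 1%g a)).
  apply: eq_tlift => a b; rewrite (bigD1 t) //= big1 ?addr0 => [|s neq].
    by rewrite mulgV na_proj_part ydpart_coassoc eqxx.
  by rewrite na_proj_part ydpart_coassoc eq_sym (negPf neq) linear0 scale0r.
by lin.
Qed.

Lemma na_top_element : exists L t,
  [/\ L != 0, pr n L = L & ydpart yd t L = L].
Proof.
have [/eqP] := top_n; rewrite -subv0 => /subvPn[_ /memv_imgP[x _ ->]].
rewrite memv0 => x_neq0 _; have [t|x0] := pickP (fun t =>
  ydpart yd t (pr n x) != 0).
  exists (ydpart yd t (pr n x)), t; split=> //.
    by rewrite na_proj_part na_projK eqxx.
  by rewrite ydpart_coassoc eqxx.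
case/eqP: x_neq0; rewrite -(ydpart_counit yd (pr n x)) big1 // => t _.
by apply/eqP; rewrite -[_ == _]negbK x0.
Qed.

(* phi is the left integral on the bosonization given by the coefficient of
   L # t^-1; the right integral is the sum of the L # g, and x yields the left
   integral, sum of the (g.x) # g. *)
Lemma na_top_span L t x : L != 0 -> pr n L = L -> ydpart yd t L = L ->
  (forall v, na_inj B v * x = 0) -> exists c, x = c *: L.
Proof.
move=> L_neq0 Ln Lt x0; have [lam lamL] := dual_separates L_neq0.
pose phi : dual H := linfun (fun h =>
  lam (ydpart yd t (pr n (bos_coord bH t^-1%g h))) : k^o).
have phiE g r : phi (bos g r) =
    if g == t^-1%g then lam (ydpart yd t (pr n r)) else 0.
  rewrite linfunE; last by lin.
  by rewrite bos_eltK eq_sym; case: eqP => // _; rewrite !linear0.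
pose u := bos_coord bH 1%g (ha_antipode hH (\sum_g bos g L)).
have uE y : (forall v, na_inj B v * y = 0) ->
    y = phi (\sum_g bos g (ydact yd g y)) *: u.
  move=> y0; pose Y := \sum_g bos g (ydact yd g y).
  transitivity (bos_coord bH 1%g (phi Y *: ha_antipode hH (\sum_g bos g L)));
    last first.
    by rewrite linearZ.
  rewrite -(hopf_integral_antipode (phi := phi) (hH := hH)).
  - rewrite linear_sum (bigD1 1%g) //= bos_eltK eqxx ydact1 big1 ?addr0 // =>
    g neq.
    by rewrite bos_eltK eq_sym (negPf neq).
  - exact: bos_integral_functional phiE.
  - exact: bos_right_integral (na_top_right top_n Ln).
  - rewrite linear_sum (bigD1 t^-1%g) //= phiE eqxx Ln Lt lamL big1 ?addr0 // =>
    g neq.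
    by rewrite phiE (negPf neq).
  - exact: bos_left_integral (na_left_integral y0).
(* [L] is itself killed by V, so both [L] and [x] are multiples of [u]; as [L] is nonzero, [u] can
   be eliminated. *)
have [c Lc] : exists c, L = c *: u.
  exists (phi (\sum_g bos g (ydact yd g L))); apply: uE => v.
  by rewrite (na_top_left top_n Ln) na_counit_inj scale0r.
have c_neq0 : c != 0 by apply: contraNneq L_neq0 => c0; rewrite Lc c0 scale0r.
exists (phi (\sum_g bos g (ydact yd g x)) / c).
by rewrite Lc scalerA divfK // -uE.
Qed.

End TopDegree.
End BosonizationIntegrals.

(** * The subalgebras of the double of the bosonization *)

Lemma annihilator_full (k : fieldType) (W : vectType k) (Y : {vspace dual W}) :
  (forall w, (forall f, f \in Y -> f w = 0) -> w = 0) -> Y = fullv.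
Proof.
move=> Y0; apply/vspaceP=> f; rewrite memvf; apply/idP; apply: contraT => fY.
pose q : 'End(dual W) := (\1 - projv Y)%VF.
have qE f' : q f' = f' - projv Y f' by rewrite add_lfunE opp_lfunE id_lfunE.
have /dual_separates[lam lam1] : q f != 0.
  by apply: contra fY; rewrite qE subr_eq0 => /eqP ->; apply: memv_proj.
(* By biduality in finite dimension, the functional lam o q on the dual is evaluation at this
   vector; it vanishes on [Y] but not at [f]. *)
pose w := \sum_(i < \dim {:W}) lam (q (dual_basis i)) *: (vbasis {:W})`_i.
have evw (f' : dual W) : f' w = lam (q f').
  rewrite {2}(dual_basis_sum f') !linear_sum; apply: eq_bigr => i _.
  by rewrite !linearZ; apply: mulrC.
have w0 : w = 0 by apply: Y0 => f' Yf';
  rewrite evw qE projv_id // subrr linear0.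
by move: (evw f); rewrite w0 linear0 lam1 => /eqP; rewrite eq_sym oner_eq0.
Qed.

Section BosonizationDouble.
Variables (k : fieldType) (gT : finGroupType).
Variables (V : vectType k) (ydV : yd_module gT V).
Variables (R : falgType k) (B : nichols_algebra ydV R).
Variables (H : falgType k) (hH : hopf_algebra H).
Variable bH : bosonization (na_hopf B) hH.
Variables (D : falgType k) (dD : drinfeld_double hH D).
Local Notation eps := (bh_counit (na_hopf B)).
Local Notation yd := (bh_yd (na_hopf B)).
Local Notation pr := (na_proj B).
Local Notation bos := (bos_elt bH).
Local Notation coordb := (bos_coord bH).

Definition dbl_functions : {vspace D} :=
  <<[seq dbl_fun bH dD (fun x => (x == g)%:R) | g : gT]>>%VS.

Lemma fun_functionalE f h :
  fun_functional bH f h = \sum_g f g * eps (coordb g h).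
Proof. by rewrite /fun_functional linfunE //; lin. Qed.

Lemma vbar_functionalE y h : vbar_functional bH y h =
  \sum_g y ((na_inj B)^-1%VF (pr 1 (coordb g h))).
Proof. by rewrite /vbar_functional linfunE //; lin. Qed.

Lemma lin_dbl_vbar : linear (dbl_vbar bH dD).
Proof.
rewrite /dbl_vbar; apply: lin_hom; apply: lin_pure2 => a y z.
apply/lfunP=> h; rewrite add_lfunE scale_lfunE !vbar_functionalE scaler_sumr.
by rewrite -big_split; apply: eq_bigr => g _; rewrite add_lfunE scale_lfunE.
Qed.

Lemma dbl_vbar_mem y : dbl_vbar bH dD y \in dbl_vbar_space bH dD.
Proof. by rewrite -(linfunE _ lin_dbl_vbar) memv_img ?memvf. Qed.

Lemma vbar_functional_bos (eta : dual R) t g r :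
  vbar_functional bH (eta \o na_inj B \o ydpart ydV t)%VF (bos g r) =
  eta (ydpart yd t (pr 1 r)).
Proof.
rewrite vbar_functionalE (bigD1 g) //= bos_eltK eqxx big1 ?addr0 => [|s neq].
  rewrite !comp_lfunE na_inj_part limg_lfunVK //.
  by rewrite na_inj_img memv_img ?memvf.
by rewrite bos_eltK (negPf neq) !linear0.
Qed.

(** Cutting V down to its component of degree t fixes the shift g -> t g of the first leg, so that a
    coderivation of the bosonization becomes one of R on coordinates. Summing over t recovers the
    whole coderivation of R. *)
Lemma bos_coord_coderivation (eta : dual R) t g h :
  coordb (t * g)%g (\sw_(a, b <- ha_comul hH h)
    (vbar_functional bH (eta \o na_inj B \o ydpart ydV t)%VF b *: a)) =
  \sw_(a, b <- bh_comul (na_hopf B) (coordb g h))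
    (eta (ydpart yd t (pr 1 b)) *: a).
Proof.
move: h; apply: (bos_linear_ext (bH := bH)) => [||s r]; [by lin|by lin|].
rewrite (bos_comul_tlift bH (F := fun a b => vbar_functional bH _ b *: a));
  last by lin.
rewrite (lin_of_tlift _ _ (f := fun z => coordb (t * g)%g z)); last by lin.
have [->|neq] := eqVneq s g.
  rewrite bos_eltK eqxx; apply: eq_tlift => a b.
  rewrite linear_sum (bigD1 t) //= big1 ?addr0 => [|t' neq].
    by rewrite vbar_functional_bos na_proj_part ydpart_coassoc eqxx linearZ /=
      bos_eltK eqxx.
  by rewrite vbar_functional_bos na_proj_part ydpart_coassoc eq_sym (negPf neq)
    linear0 scale0r linear0.
rewrite bos_eltK eq_sym (negPf neq) linear0 tlift0 tlift_eq0 // => a b.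
rewrite linear_sum big1 // => t' _ /=.
rewrite vbar_functional_bos na_proj_part ydpart_coassoc.
have [<-|_] := eqVneq; last by rewrite linear0 scale0r linear0.
rewrite linearZ /= bos_eltK (inj_eq (mulgI t)) eq_sym (negPf neq).
by rewrite scaler0.
Qed.

(* The annihilator Z of the right-hand side is stable under the coderivations
   h |-> h_(1) <y, h_(2)>; since these detect every positive degree, an
   induction on the degree shows that Z = 0. *)
Lemma dbl_dual_generated f :
  dbl_dual dD f \in (dbl_nichols_bar bH dD * dbl_functions)%VS.
Proof.
pose Y := (linfun (dbl_dual dD) @^-1: (dbl_nichols_bar bH dD *
  dbl_functions))%VS.
have YE f0 : (f0 \in Y) =
    (dbl_dual dD f0 \in (dbl_nichols_bar bH dD * dbl_functions)%VS).
  by rewrite -memv_preim linfunE //; apply: lin_dbl_dual.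
suff Yfull : Y = fullv by rewrite -YE Yfull memvf.
apply: annihilator_full => h h0.
pose Z h := forall f0, f0 \in Y -> f0 h = 0.
have Zder h' y : Z h' -> Z (\sw_(a, b <- ha_comul hH h') (vbar_functional bH y b
  *: a)).
  move=> Zh f0 Yf0; rewrite -[RHS](Zh (dual_mul hH f0 (vbar_functional bH y))).
    rewrite dual_mulE (lin_of_tlift _ _ (f := fun z => f0 z)); last by lin.
    by apply: eq_tlift => a b; rewrite linearZ; apply: mulrC.
  (* Inside the double this product is y times [f0], in this order, and B(Vbar) absorbs y on the
     left. *)
  rewrite YE dbl_dualM /dbl_nichols_bar -agenvM -prodvA memv_mul //.
    by apply: (subvP (sub_agenv _)); apply: dbl_vbar_mem.
  by rewrite -YE.
have Zpr i : forall h', Z h' -> forall g, pr i (coordb g h') = 0.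
  elim: i => [|i IHi] h' Zh g.
    rewrite na_proj0E -[eps _](_ : fun_functional bH (fun x => (x == g)%:R) h' =
      _).
      rewrite Zh ?scale0r // YE -[dbl_dual _ _]mul1r memv_mul //.
        by rewrite (subvP (sub1_agenv _)) ?memv_line.
      by rewrite memv_span //; apply: map_f; rewrite mem_enum.
    rewrite fun_functionalE (bigD1 g) //= eqxx mul1r big1 ?addr0 // => s neq.
    by rewrite (negPf neq) mul0r.
  apply: (nichols_coderivation (B := B) (n := i.+1)) => //.
    by rewrite na_projK eqxx.
  rewrite (tlift_projr B (F := fun a b => pure a b)); last by lin.
  rewrite subn1 /=; apply: tens_eqr => eta; rewrite tlift0 tlift_tlift.
  transitivity (\sum_t pr i (coordb (t * g)%g (\sw_(a, b <- ha_comul hH h')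
    (vbar_functional bH (eta \o na_inj B \o ydpart ydV t)%VF b *: a)))).
    under [RHS]eq_bigr => t _.
      rewrite bos_coord_coderivation (lin_of_tlift _ _ (f := fun z => pr i z));
        last by lin.
      over.
    rewrite -tlift_sumr; apply: eq_tlift => a b.
    rewrite tlift_pure; last by lin.
    rewrite -{1}(ydpart_counit yd (pr 1 b)) linear_sum scaler_suml.
    by apply: eq_bigr => t _; rewrite linearZ.
  by rewrite big1 // => t _; apply: IHi; apply: Zder.
rewrite -(bos_coordK bH h) big1 // => g _;
  rewrite [coordb g h](_ : _ = 0) ?linear0 //.
by apply: (na_proj_ext (B := B)) => m; rewrite Zpr // linear0.
Qed.

End BosonizationDouble.

(** * Commutation relations in the double of the bosonization *)

Section DoubleRelations.
Variables (k : fieldType) (gT : finGroupType).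
Variables (V : vectType k) (ydV : yd_module gT V).
Variables (R : falgType k) (B : nichols_algebra ydV R).
Variables (H : falgType k) (hH : hopf_algebra H).
Variable bH : bosonization (na_hopf B) hH.
Variables (D : falgType k) (dD : drinfeld_double hH D).
Local Notation eps := (bh_counit (na_hopf B)).
Local Notation yd := (bh_yd (na_hopf B)).
Local Notation bos := (bos_elt bH).
Local Notation iN := (dbl_nichols bH dD).
Local Notation iG := (dbl_grp bH dD).
Local Notation iF := (dbl_dual dD).

Lemma lin_dbl_nichols : linear iN.
Proof. by rewrite /dbl_nichols; lin. Qed.

Lemma dbl_nichols1 : iN 1 = 1.
Proof. by rewrite /dbl_nichols bos_one dd_one. Qed.

Lemma dbl_nicholsM r s : iN (r * s) = iN r * iN s.
Proof. by rewrite -[RHS]dbl_hopfM bos_mul ydact1 mulg1. Qed.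

Lemma dbl_hopf_bos g r : dbl_hopf dD (bos g r) = iN r * iG g.
Proof. by rewrite -[RHS]dbl_hopfM bos_mul ydact1 mul1g mulr1. Qed.

Lemma dbl_grpM g h : iG (g * h)%g = iG g * iG h.
Proof. by rewrite -[RHS]dbl_hopfM bos_mul bh_act1 mulr1. Qed.

Lemma dbl_grp1 : iG 1%g = 1. Proof. exact: dbl_nichols1. Qed.

Lemma dbl_grp_nichols g r : iG g * iN r = iN (ydact yd g r) * iG g.
Proof. by rewrite -[LHS]dbl_hopfM bos_mul mulg1 mul1r dbl_hopf_bos. Qed.

Lemma bos_grpM g h : bos g 1 * bos h 1 = bos (g * h)%g 1.
Proof. by rewrite bos_mul bh_act1 mulr1. Qed.

Lemma bos_comul_grp (W : vectType k) (F : H -> H -> W) g :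
    bilinear_map F ->
  \sw_(a, b <- ha_comul hH (bos g 1)) F a b = F (bos g 1) (bos g 1).
Proof.
move=> bF; have [lF1 lF2] := bF; rewrite (bos_comul_tlift bH (F :=
  F)) // bh_comul1.
rewrite tlift_pure.
  rewrite (bigD1 1%g) //= big1 ?addr0 => [|t neq].
    by rewrite mul1g bh_part1 eqxx.
  by rewrite bh_part1 (negPf neq) linear0 (linear0E (lF1 _)).
split=> [a|b].
  by apply: lin_sum => t c y z; rewrite !linearP lF1.
by apply: lin_sum => t c y z; rewrite !linearP lF2.
Qed.

Lemma antipode_grp g : ha_antipode hH (bos g 1) = bos g^-1%g 1.
Proof.
have := ha_antipodel hH (bos g 1); rewrite bos_comul_grp; last by lin.
rewrite bos_counit bh_counit1 scale1r => /(congr1 (fun z => z * bos g^-1%g 1)).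
by rewrite -mulrA bos_grpM mulgV bos_one mulr1 mul1r.
Qed.

Lemma dbl_dual_grp f g :
  iF f * iG g = iG g * iF (two_sided_shift f (bos g 1) (bos g^-1%g 1)).
Proof.
rewrite [LHS]dbl_dual_hopf bos_comul_grp.
  rewrite bos_comul_grp ?antipode_grp //.
  by rewrite /dbl_hopf /dbl_dual; lin.
by rewrite /dbl_hopf /dbl_dual; lin.
Qed.

Lemma dbl_grp_dual f g :
  iG g * iF f = iF (two_sided_shift f (bos g^-1%g 1) (bos g 1)) * iG g.
Proof.
rewrite dbl_dual_grp; congr (_ * iF _); apply/lfunP=> z.
rewrite !two_sided_shiftE -!mulrA bos_grpM mulVg bos_one mulr1.
by rewrite mulrA bos_grpM mulVg bos_one mul1r.
Qed.

Lemma bos_comul_inj (W : vectType k) (F : H -> H -> W) t v :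
    bilinear_map F -> ydpart ydV t v = v ->
  \sw_(a, b <- ha_comul hH (bos 1%g (na_inj B v))) F a b =
  F (bos 1%g (na_inj B v)) 1 + F (bos t 1) (bos 1%g (na_inj B v)).
Proof.
move=> bF vt; have [lF1 lF2] := bF; rewrite (bos_comul_tlift bH (F := F)) //.
have bF' : bilinear_map (fun a b =>
    \sum_t F (bos (t * 1)%g a) (bos 1%g (ydpart yd t b))).
  split=> [a|b]; first by apply: lin_sum => s c y z; rewrite !linearP lF1.
  by apply: lin_sum => s c y z; rewrite !linearP lF2.
have -> : bh_comul (na_hopf B) (na_inj B v) =
    pure (na_inj B v) 1 + pure 1 (na_inj B v).
  by apply/na_primitive; rewrite -na_inj_img memv_img ?memvf.
rewrite tliftD !tlift_pure //; congr (_ + _).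
  rewrite (bigD1 1%g) //= big1 ?addr0 => [|s neq].
    by rewrite mul1g bh_part1 eqxx bos_one.
  by rewrite bh_part1 (negPf neq) linear0 (linear0E (lF1 _)).
rewrite (bigD1 t) //= big1 ?addr0 => [|s neq].
  by rewrite mulg1 -na_inj_part vt.
rewrite -na_inj_part -vt ydpart_coassoc (negPf neq) !linear0.
by rewrite (linear0E (lF1 _)).
Qed.

(** The twofold comultiplication of v is v (x) 1 (x) 1 + t (x) v (x) 1 + t (x) t (x) v. Expanding f'
    v accordingly gives three terms, and the translation by t^-1 in f' makes the middle one equal to
    v f, for which the relation is solved. *)
Lemma dbl_nichols_dual f t v : ydpart ydV t v = v ->
  let f' := two_sided_shift f (bos t^-1%g 1) 1 in
  let h := bos 1%g (na_inj B v) in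
  iN (na_inj B v) * iF f = iF f' * iN (na_inj B v) - iF (two_sided_shift f' h 1)
    - iG t * iF (two_sided_shift f' (bos t 1) (ha_antipode hH h)).
Proof.
move=> vt f' h; have -> : iF f' * iN (na_inj B v) = iF f' * dbl_hopf dD h by [].
rewrite dbl_dual_hopf (bos_comul_inj (t := t)) //; last first.
  by rewrite /dbl_hopf /dbl_dual; lin.
rewrite (bos_comul_inj (t := t)) //; last first.
  by rewrite /dbl_hopf /dbl_dual; lin.
rewrite ha_comul1 tlift_pure; last by rewrite /dbl_hopf /dbl_dual; lin.
rewrite antipode1 dbl_hopf1 mul1r [X in X - _ - _]addrC !addrK;
  congr (_ * iF _).
apply/lfunP=> z; rewrite !two_sided_shiftE !mulr1 mulrA bos_grpM mulVg.
by rewrite bos_one mul1r.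
Qed.

Lemma fun_functional_mull f g r z :
  fun_functional bH f (bos g r * z) =
  eps r * fun_functional bH (fun x => f (g * x)%g) z.
Proof.
move: z; apply: (bos_linear_ext (bH := bH) (W := k^o)) => [||s r'];
  [by lin|by lin|].
rewrite bos_mul !fun_functionalE (bigD1 (g * s)%g) //= [in RHS](bigD1 s) //=.
rewrite !bos_eltK !eqxx !big1 ?addr0 => [|t neq|t neq].
- by rewrite bh_counitM bh_counit_act mulrCA.
- by rewrite bos_eltK (negPf neq) linear0 mulr0.
- by rewrite bos_eltK (negPf neq) linear0 mulr0.
Qed.

Lemma fun_functional_mulr f z s r :
  fun_functional bH f (z * bos s r) =
  fun_functional bH (fun x => f (x * s)%g) z * eps r.
Proof.
move: z; apply: (bos_linear_ext (bH := bH) (W := k^o)) => [||g r'];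
  [by lin|by lin|].
rewrite bos_mul !fun_functionalE (bigD1 (g * s)%g) //= [in RHS](bigD1 g) //=.
rewrite !bos_eltK !eqxx !big1 ?addr0 => [|t neq|t neq].
- by rewrite bh_counitM bh_counit_act mulrA.
- by rewrite bos_eltK (negPf neq) linear0 mulr0.
- by rewrite bos_eltK (negPf neq) linear0 mulr0.
Qed.

Lemma eq_fun_functional f f' : f =1 f' -> fun_functional bH f =
  fun_functional bH f'.
Proof.
move=> e; apply/lfunP=> h; rewrite !fun_functionalE.
by apply: eq_bigr => g _; rewrite e.
Qed.

(** Avoids an explicit antipode: in S(a_(1)) a_(2) = eps(a) the functional sees the second leg only
    through its counit, which leaves S of the element itself. *)
Lemma fun_functional_antipode f z r :
  fun_functional bH f (z * ha_antipode hH (bos 1%g r)) =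
  fun_functional bH f z * eps r.
Proof.
have e := ha_antipodel hH (bos 1%g r).
transitivity (fun_functional bH f (z * (ha_counit hH (bos 1%g r) *: 1)));
  last first.
  by rewrite bos_counit -scalerAr mulr1 linearZ; apply: mulrC.
rewrite -e bos_comul_tlift; last by lin.
rewrite (lin_of_tlift _ _ (f := fun y => fun_functional bH f (z * y)));
  last by lin.
rewrite -{1}(bh_counitr (na_hopf B) r).
rewrite (lin_of_tlift _ _ (f := fun y =>
  fun_functional bH f (z * ha_antipode hH (bos 1%g y))));
  last by lin.
apply: eq_tlift => a b; rewrite mulr_sumr linear_sum (bigD1 1%g) //= big1
  ?addr0.
  rewrite mulg1 mulrA fun_functional_mulr bh_counit_part eqxx.
  rewrite !linearZ /= -scalerAr linearZ /= mulrC; congr (_ * _).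
  by congr (fun_of_lfun _ _); apply: eq_fun_functional => x; rewrite mulg1.
move=> t neq; rewrite mulrA fun_functional_mulr bh_counit_part (negPf neq).
by rewrite mulr0.
Qed.

(** A function vanishes in positive degrees, so the outer legs of the twofold comultiplication enter
    through their counits; what survives is the coaction, which translates the argument of f. *)
Lemma dbl_fun_nichols f r :
  dbl_fun bH dD f * iN r =
  \sum_t iN (ydpart yd t r) * dbl_fun bH dD (fun x => f (t * x)%g).
Proof.
have shiftE t a b : two_sided_shift (fun_functional bH f) (bos t a)
    (ha_antipode hH (bos 1%g b)) =
    (eps a * eps b) *: fun_functional bH (fun x => f (t * x)%g).
  apply/lfunP=> z; rewrite two_sided_shiftE fun_functional_antipode.
  by rewrite fun_functional_mull scale_lfunE -mulrA [X in _ * X]mulrC mulrA.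
have KE t a b : \sw_(h2, h3 <- ha_comul hH (bos 1%g b))
    (dbl_hopf dD h2 *
     iF (two_sided_shift (fun_functional bH f) (bos t a) (ha_antipode hH h3))) =
    eps a *: (iN b * dbl_fun bH dD (fun x => f (t * x)%g)).
  rewrite (bos_comul_tlift bH (F := fun h2 h3 => dbl_hopf dD h2 *
    iF (two_sided_shift (fun_functional bH f) (bos t a) (ha_antipode hH h3)))).
    rewrite -{2}(bh_counitr (na_hopf B) b) (lin_of_tlift _ _ (f := fun z =>
      eps a *: (iN z * dbl_fun bH dD (fun x => f (t * x)%g)))).
      apply: eq_tlift => c d; rewrite (bigD1 1%g) //= big1 ?addr0 => [|s neq].
        rewrite mulg1 shiftE bh_counit_part eqxx (linearZE _ _ (lin_dbl_dual
          dD)).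
        by rewrite (linearZE _ _ lin_dbl_nichols) -scalerAl scalerA -scalerAr.
      rewrite shiftE bh_counit_part (negPf neq) mulr0 scale0r.
      by rewrite (linear0E (lin_dbl_dual dD)) mulr0.
    by rewrite /dbl_nichols; lin.
  by rewrite /dbl_hopf /dbl_dual; lin.
rewrite [LHS]dbl_dual_hopf (bos_comul_tlift bH (F := fun h1 h23 =>
  \sw_(h2, h3 <- ha_comul hH h23) (dbl_hopf dD h2 *
    iF (two_sided_shift (fun_functional bH f) h1 (ha_antipode hH h3)))));
      last first.
  by rewrite /dbl_hopf /dbl_dual; lin.
rewrite -{2}(bh_counitl (na_hopf B) r) (lin_of_tlift _ _ (f := fun z =>
  \sum_t iN (ydpart yd t z) * dbl_fun bH dD (fun x => f (t * x)%g)));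
    last first.
  by rewrite /dbl_nichols; lin.
apply: eq_tlift => a b; apply: eq_bigr => t _.
by rewrite mulg1 KE linearZ /= (linearZE _ _ lin_dbl_nichols) -scalerAl.
Qed.

End DoubleRelations.

(** * Weight modules and Verma modules *)

Section TensorOver.
Variable k : fieldType.

(** Both 0 and the projection with kernel [Y] induce the zero balanced map, so uniqueness in the
    universal property makes them equal. *)
Lemma tensor_over_span (X U W : vectType k) (A : Type) (ra : A -> X -> X)
    (la : A -> U -> U) (t : X -> U -> W) (Y : {vspace W}) :
    is_tensor_over ra la t -> (forall x u, t x u \in Y) -> forall w, w \in Y.
Proof.
move=> [_ univ] tY w.
have [|phi [_ uniq]] := univ W (fun _ _ => 0).
  by split=> //; lin.
have := uniq (\1 - projv Y)%VF; rewrite (uniq 0%VF); last first.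
  by move=> x u; rewrite lfunE.
move=> /(_ _) e; have /lfunP/(_ w) : 0%VF = (\1 - projv Y)%VF.
  by apply: e => x u; rewrite add_lfunE opp_lfunE id_lfunE projv_id ?subrr.
rewrite add_lfunE opp_lfunE id_lfunE zero_lfunE => /esym/eqP.
by rewrite subr_eq0 => /eqP ->; apply: memv_proj.
Qed.

Lemma span_prod_mem (U V W : vectType k) (b : U -> V -> W)
    (X : {vspace U}) (Y : {vspace V}) x y :
  bilinear_map b -> x \in X -> y \in Y -> b x y \in span_prod b X Y.
Proof.
move=> [lb1 lb2] xX yY; rewrite (coord_vbasis xX) (linear_sumE _ _ _ (lb2 _)).
apply: memv_suml => i _; rewrite (linearZE _ _ (lb2 _)) memvZ //.
rewrite (coord_vbasis yY) (linear_sumE _ _ _ (lb1 _)).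
apply: memv_suml => j _; rewrite (linearZE _ _ (lb1 _)) memvZ //.
by apply/memv_span/allpairsP; exists ((vbasis X)`_i, (vbasis Y)`_j);
  split=> //=; rewrite mem_nth // size_tuple.
Qed.

Lemma span_prod_sub (U V W : vectType k) (b : U -> V -> W)
    (X : {vspace U}) (Y : {vspace V}) (Z : {vspace W}) :
  (forall x y, x \in X -> y \in Y -> b x y \in Z) ->
  forall w, w \in span_prod b X Y -> w \in Z.
Proof.
move=> bZ; apply/subvP/span_subvP=> _ /allpairsP[[x y] /= [xX yY ->]].
by apply: bZ; apply: vbasis_mem.
Qed.

End TensorOver.

(** * The simple modules M(g, rho) of the double of the group *)

Section WeightModule.
Variables (k : fieldType) (gT : finGroupType).
Variables (V : vectType k) (ydV : yd_module gT V).
Variables (R : falgType k) (B : nichols_algebra ydV R).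
Variables (H : falgType k) (hH : hopf_algebra H).
Variable bH : bosonization (na_hopf B) hH.
Variables (D : falgType k) (dD : drinfeld_double hH D).
Variables (g : gT) (U : vectType k) (rho : subg_of 'C[g]%G -> 'End(U)).
Variables (M : vectType k) (wM : weight_module bH dD rho M).
Local Notation iG := (dbl_grp bH dD).
Local Notation iF := (dbl_dual dD).
Local Notation ge0 := (dbl_ge0 bH dD).
Local Notation Dge0 :=
  (agenv_aspace (dbl_DG bH dD + dbl_vbar_space bH dD)%VS).
Local Notation t := (wm_tensor wM).

Lemma dbl_ge0E : ge0 = agenv
  (<<[seq iG x | x : gT]>> + dbl_functions bH dD + dbl_vbar_space bH dD)%VS.
Proof. exact: agenv_add_id. Qed.

Lemma dbl_grp_ge0 x : iG x \in ge0.
Proof.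
rewrite dbl_ge0E; apply: (subvP (sub_agenv _)); rewrite -[iG x]addr0 -addvA.
by rewrite memv_add ?mem0v // memv_span //; apply: map_f; rewrite mem_enum.
Qed.

Lemma dbl_dual_ge0 f : iF f \in ge0.
Proof.
have mem := dbl_dual_generated bH dD f.
apply: subvP mem; rewrite dbl_ge0E -[X in (_ <= X)%VS]agenvM; apply: prodvS.
  by apply: agenvS; apply: addvSr.
by apply: subv_trans (sub_agenv _); apply: subv_trans (addvSr _ _) (addvSl _ _).
Qed.

Lemma dbl_ge0M x y : x \in ge0 -> y \in ge0 -> x * y \in ge0.
Proof. by move=> x_ge0 y_ge0; rewrite /dbl_ge0 -agenvM memv_mul. Qed.

(** Extended to all of D by a linear projection to avoid the subtype; it is the module action only
    on [dbl_ge0]. *)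
Definition weight_act (d : D) (m : M) : M := wm_act wM (vsproj Dge0 d) m.

Lemma lin_weight_act1 m : linear (fun d => weight_act d m).
Proof. by move=> a d d'; rewrite /weight_act linearP;
  case: (wm_module wM) => [[_ ->]]. Qed.

Lemma lin_weight_act2 d : linear (weight_act d).
Proof. by rewrite /weight_act; case: (wm_module wM) => [[l _] _ _];
  apply: l. Qed.

Lemma weight_act1 m : weight_act 1 m = m.
Proof.
have [_ act1 _] := wm_module wM; rewrite /weight_act -[RHS]act1; congr wm_act.
have one_in : 1 \in Dge0 by apply: (subvP (sub1_agenv _)); apply: memv_line.
by apply: val_inj; rewrite /= vsprojK //; apply/esym/eqP; rewrite algid_eq1.
Qed.

Lemma weight_act_grp x F u : weight_act (iG x) (t F u) = t (ga_mull x F) u.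
Proof. by apply: wm_act_grp; rewrite vsprojK // dbl_grp_ge0. Qed.

Lemma weight_act_fun f x u : weight_act (dbl_fun bH dD f) (t (ga_elt k x) u) =
  f (x * g * x^-1)%g *: t (ga_elt k x) u.
Proof. by apply: wm_act_fun; rewrite vsprojK // dbl_dual_ge0. Qed.

Lemma wm_tensor_bilinear : bilinear_map t.
Proof. by case: (wm_tensorP wM) => [[]]. Qed.

Lemma lin_wt1 u : linear (t^~ u). Proof. by case: wm_tensor_bilinear. Qed.
Lemma lin_wt2 F : linear (t F). Proof. by case: wm_tensor_bilinear. Qed.

Lemma ga_sum (F : grp_alg k gT) : F = \sum_x F x *: ga_elt k x.
Proof.
apply/ffunP=> y; rewrite sum_ffunE (bigD1 y) //= !ffunE eqxx [_ *: _]mulr1.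
rewrite big1 ?addr0 // => x neq; rewrite !ffunE eq_sym (negPf neq).
exact: mulr0.
Qed.

Lemma ga_mull_elt (x y : gT) : ga_mull x (ga_elt k y) = ga_elt k (x * y)%g.
Proof. by apply/ffunP=> z; rewrite !ffunE (can2_eq (mulKVg x) (mulKg x)). Qed.

Lemma ga_mulr_elt (x y : gT) : ga_mulr x (ga_elt k y) = ga_elt k (y * x)%g.
Proof. by apply/ffunP=> z; rewrite !ffunE (can2_eq (mulgKV x) (mulgK x)). Qed.

Lemma wt_elt_ind (X : {vspace M}) :
  (forall x u, t (ga_elt k x) u \in X) -> forall m, m \in X.
Proof.
move=> tX; apply: (tensor_over_span (wm_tensorP wM)) => F u.
rewrite (ga_sum F) (linear_sumE _ _ _ (lin_wt1 u)); apply: memv_suml => x _.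
by rewrite (linearZE _ _ (lin_wt1 u)) memvZ.
Qed.

Lemma wt_rho x c u : t (ga_elt k x) (rho c u) = t (ga_elt k (x * sgval c)%g) u.
Proof.
have [[_ bal] _] := wm_tensorP wM.
by rewrite -ga_mulr_elt -bal.
Qed.

Let delta h := dbl_fun bH dD (fun x => (x == h)%:R).

Lemma weight_act_delta_sum m : \sum_h weight_act (delta h) m = m.
Proof.
have lf : linear (fun m => \sum_h weight_act (delta h) m).
  by apply: lin_sum => h; apply: lin_weight_act2.
apply/eqP; rewrite -subr_eq0 -(linfunE m lf) -[m in X in _ - X]id_lfunE.
rewrite -opp_lfunE -add_lfunE -memv_ker; move: m; apply: wt_elt_ind => x u.
rewrite memv_ker add_lfunE opp_lfunE id_lfunE linfunE // subr_eq0; apply/eqP.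
rewrite (bigD1 (x * g * x^-1)%g) //= big1 ?addr0 => [|h neq].
  by rewrite weight_act_fun eqxx scale1r.
by rewrite weight_act_fun eq_sym (negPf neq) scale0r.
Qed.

(** If x and y conjugate g to the same h, then x^-1 y centralizes g and moves across the tensor
    sign, so a single x serves the whole h-component. *)
Lemma weight_act_delta h m : exists x u, weight_act (delta h) m =
  t (ga_elt k x) u.
Proof.
(* When h is not conjugate to g, the function at h acts by zero and the default 1 will do. *)
pose x := odflt 1%g [pick x | (x * g * x^-1)%g == h].
pose Y := (linfun (weight_act (delta h)) @^-1:
  limg (linfun (t (ga_elt k x))))%VS.
have YE m' : (m' \in Y) = (weight_act (delta h) m' \in limg (linfun (t (ga_elt k
  x)))).
  by rewrite -memv_preim linfunE //; apply: lin_weight_act2.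
have: m \in Y.
  apply: wt_elt_ind => y u; rewrite YE weight_act_fun.
  have [eh|_] := eqVneq; last by rewrite scale0r mem0v.
  rewrite scale1r.
  have xh : (x * g * x^-1)%g = h.
    rewrite /x; case: pickP => [x' /eqP //|/(_ y)]; by rewrite eh eqxx.
  have xyC : (x^-1 * y)%g \in 'C[g]%G.
    apply/cent1P; rewrite /commute.
    have e : (x * g)%g = (y * g * y^-1 * x)%g by rewrite eh -xh mulgKV.
    by apply: (mulgI x); rewrite !mulgA mulgV mul1g e mulgK mulgKV.
  rewrite -(mulKVg x y) -(subgK _ xyC).
  by rewrite -wt_rho -(linfunE _ (lin_wt2 _)) memv_img ?memvf.
rewrite YE => /memv_imgP[u _]; rewrite (linfunE _ (lin_wt2 _)) => e.
by exists x, u.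
Qed.

Hypothesis irr_rho : is_irreducible_repr rho.

(** The vectors u with 1 (x) u in [N] form a subrepresentation of the centralizer. It is nonzero:
    some h-component x (x) u of a nonzero element of [N] is nonzero, and x^-1 carries it to 1 (x)
    u. *)
Lemma weight_module_simple (N : {vspace M}) : N != 0%VS ->
    (forall x m, m \in N -> weight_act (iG x) m \in N) ->
    (forall f m, m \in N -> weight_act (dbl_fun bH dD f) m \in N) ->
  N = fullv.
Proof.
move=> N_neq0 NG NF; have [_ _ _ irr] := irr_rho.
pose U1 := (linfun (t (ga_elt k 1%g)) @^-1: N)%VS.
have U1E u : (u \in U1) = (t (ga_elt k 1%g) u \in N).
  by rewrite -memv_preim linfunE //; apply: lin_wt2.
have U1full : U1 = fullv.
  case: (irr U1) => // [c u|U10].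
    rewrite !U1E wt_rho mul1g => /(NG (sgval c)).
    by rewrite weight_act_grp ga_mull_elt mulg1.
  case/eqP: N_neq0; apply/eqP; rewrite -subv0; apply/subvP=> m mN.
  rewrite memv0 -(weight_act_delta_sum m) big1 // => h _.
  have [x [u e]] := weight_act_delta h m.
  have: u \in U1.
    rewrite U1E; have := NG x^-1%g _ (NF (fun y => (y == h)%:R) m mN).
    by rewrite -/(delta h) e weight_act_grp ga_mull_elt mulVg.
  rewrite U10 memv0 => /eqP u0.
  by rewrite e u0 (linear0E (lin_wt2 _)).
apply/vspaceP=> m; rewrite memvf; apply: wt_elt_ind => x u.
have := memvf u; rewrite -U1full U1E => /(NG x).
by rewrite weight_act_grp ga_mull_elt mulg1.
Qed.

Lemma weight_module_neq0 : exists m : M, m != 0.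
Proof.
have [rho1 rhoM U_neq0 _] := irr_rho.
have [u u_neq0] : exists u : U, u != 0.
  exists (vpick {:U}); rewrite vpick0; exact/eqP.
(* This balanced map projects the induced module onto the summand of the trivial coset, and it sends
   1 (x) u to u. *)
pose s (F : grp_alg k gT) u := \sum_c F (sgval c) *: rho c u.
have [_ /(_ U s)[|phi [phiE _]]] := wm_tensorP wM.
  split=> [|c F u']; first split=> [F|u'].
  - by rewrite /s; lin.
  - by apply: lin_sum => c a F F'; rewrite !ffunE scalerDl -scalerA.
  rewrite /s (reindex_inj (mulIg c)) /=; apply: eq_bigr => c' _.
  by rewrite ffunE rhoM mulgK.
exists (t (ga_elt k 1%g) u); apply: contraNneq u_neq0 => tu0.
have := phiE (ga_elt k 1%g) u; rewrite tu0 linear0 /s (bigD1 1%g) //= big1 =>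
  [|c neq].
  by rewrite ffunE eqxx scale1r rho1 addr0 => <-.
rewrite ffunE; case: eqP => [e|_]; last by rewrite scale0r.
by case/eqP: neq; apply: val_inj.
Qed.

End WeightModule.

(** * Algebra elements that preserve a subspace *)

Section Stabilizer.
Variables (k : fieldType) (A : falgType k) (W : vectType k).
Variable act : A -> W -> W.
Hypothesis actP : is_module act.

Lemma lin_act1 w : linear (fun a => act a w).
Proof. by case: actP => [[]]. Qed.

Lemma lin_act2 a : linear (act a).
Proof. by case: actP => [[]]. Qed.

(** Written as the kernel of a -> (1 - p) a p, with p a projection onto S, so as to be a subspace,
    to which spanning arguments apply. *)
Definition stabilizer (S : {vspace W}) : {vspace A} := lker (linfun (fun a =>
  ((\1 - projv S) \o (linfun (act a) \o projv S))%VF : 'End(W))).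

Lemma stabilizerP (S : {vspace W}) a :
  reflect (forall s, s \in S -> act a s \in S) (a \in stabilizer S).
Proof.
have lf : linear (fun a =>
    ((\1 - projv S) \o (linfun (act a) \o projv S))%VF : 'End(W)).
  move=> c x y; apply/lfunP=> w; rewrite add_lfunE scale_lfunE !comp_lfunE.
  by rewrite !(linfunE _ (lin_act2 _)) lin_act1 linearP.
have fE s : s \in S -> ((\1 - projv S) \o (linfun (act a) \o projv S))%VF s =
    act a s - projv S (act a s).
  move=> sS; rewrite !comp_lfunE (projv_id sS) linfunE; last exact: lin_act2.
  by rewrite add_lfunE opp_lfunE id_lfunE.
rewrite memv_ker linfunE //; apply: (iffP eqP) => [/lfunP e s sS | stab].
  have := e s; rewrite fE // zero_lfunE => /eqP; rewrite subr_eq0 => /eqP ->.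
  exact: memv_proj.
apply/lfunP=> s; rewrite zero_lfunE; have pS := memv_proj S s.
by have := fE _ pS; rewrite (projv_id (stab _ pS)) subrr !comp_lfunE (projv_id
  pS).
Qed.

End Stabilizer.

(** * The Verma module as B(V) (x) M *)

Section Verma.
Variables (k : fieldType) (gT : finGroupType).
Variables (V : vectType k) (ydV : yd_module gT V).
Variables (R : falgType k) (B : nichols_algebra ydV R).
Variables (H : falgType k) (hH : hopf_algebra H).
Variable bH : bosonization (na_hopf B) hH.
Variables (D : falgType k) (dD : drinfeld_double hH D).
Variables (g : gT) (U : vectType k) (rho : subg_of 'C[g]%G -> 'End(U)).
Variables (M : vectType k) (wM : weight_module bH dD rho M).
Variables (W : vectType k) (vW : verma_module wM W).
Local Notation bos := (bos_elt bH).
Local Notation coordb := (bos_coord bH).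
Local Notation iN := (dbl_nichols bH dD).
Local Notation iG := (dbl_grp bH dD).
Local Notation iF := (dbl_dual dD).
Local Notation ge0 := (dbl_ge0 bH dD).
Local Notation T := (vm_tensor vW).
Local Notation wact := (weight_act wM).

(* The double is B(V) (x) D(G) B(Vbar); this contracts the first factor. *)
Definition triangular_coord (lam : dual R) (d : D) : D :=
  \sw_(h, f <- (dd_elt dD)^-1%VF d)
    \sum_s lam (coordb s h) *: (iG s * iF f).

Lemma lin_triangular_coord lam : linear (triangular_coord lam).
Proof. by rewrite /triangular_coord; lin. Qed.

Lemma triangular_coordE lam h f :
  triangular_coord lam (dd_elt dD (pure h f)) =
  \sum_s lam (coordb s h) *: (iG s * iF f).
Proof.
have inj : lker (dd_elt dD) == 0%VS by apply/lker0P/bij_inj/dd_bij.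
rewrite /triangular_coord lker0_lfunK // tlift_pure //.
by rewrite /dbl_dual; lin.
Qed.

Lemma triangular_coord_ge0 lam d : triangular_coord lam d \in ge0.
Proof.
apply: memv_suml => i _; apply: memv_suml => j _; apply: memvZ.
apply: memv_suml => s _; apply: memvZ.
by apply: dbl_ge0M; [apply: dbl_grp_ge0 | apply: dbl_dual_ge0].
Qed.

Lemma triangular_coord_nichols lam r : triangular_coord lam (iN r) = lam r *: 1.
Proof.
rewrite triangular_coordE (bigD1 1%g) //= bos_eltK eqxx big1 ?addr0 => [|s neq].
  by rewrite dbl_grp1 dbl_dual1 mulr1.
by rewrite bos_eltK (negPf neq) linear0 scale0r.
Qed.

Lemma bos_coord_mulg h s x : coordb (s * x)%g (h * bos x 1) = coordb s h.
Proof.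
move: h; apply: (bos_linear_ext (bH := bH)) => [||y r]; [by lin|by lin|].
by rewrite bos_mul bh_act1 mulr1 !bos_eltK (inj_eq (mulIg x)).
Qed.

(** Right multiplication by the nonnegative part leaves the factor B(V) alone. The elements [a] with
    this property form a subspace closed under products, which reduces the claim to functionals and
    group elements. *)
Lemma triangular_coordM lam d a : a \in ge0 ->
  triangular_coord lam (d * a) = triangular_coord lam d * a.
Proof.
pose p := triangular_coord lam; have lp : linear p by apply:
  lin_triangular_coord.
have [F FE] : exists F : D -> 'End(D), forall b d', F b d' =
  p (d' * b) - p d' * b.
  exists (fun a => linfun (fun d => p (d * a)) - linfun (fun d => p d * a)) =>
    b d'.
  rewrite add_lfunE opp_lfunE !linfunE //; first exact: lin_mull.
  by move=> c x y; rewrite mulrDl -scalerAl lp.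
have lF : linear F.
  move=> c x y; apply/lfunP=> d'; rewrite add_lfunE scale_lfunE !FE.
  by rewrite !mulrDr -!scalerAr lp scalerBr opprD addrACA.
pose X := lker (linfun F).
have XP b : reflect (forall d', p (d' * b) = p d' * b) (b \in X).
  rewrite memv_ker linfunE //; apply: (iffP eqP) => [/lfunP e d'|e].
    by apply/eqP; rewrite -subr_eq0 -FE e zero_lfunE.
  by apply/lfunP=> d'; rewrite FE e subrr zero_lfunE.
suff sub : (ge0 <= X)%VS by move/(subvP sub)/XP; apply.
have X1 : 1 \in X by apply/XP=> d'; rewrite !mulr1.
have XX : (X * X <= X)%VS.
  apply/prodvP=> x y /XP Xx /XP Xy; apply/XP=> d'.
  by rewrite !mulrA Xy Xx.
have ext b : (forall h f, p (dd_elt dD (pure h f) * b) =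
  p (dd_elt dD (pure h f)) * b) ->
    b \in X.
  move=> e; apply/XP=> d'; apply/eqP; rewrite -subr_eq0 -FE -memv_ker.
  by apply: (dbl_span (dD := dD)) => h f;
    rewrite memv_ker FE dbl_hopf_dual e subrr.
have XF f' : iF f' \in X.
  apply: ext => h f; rewrite dd_mul_dual /p !triangular_coordE mulr_suml.
  by apply: eq_bigr => s _; rewrite dbl_dualM mulrA scalerAl.
have XG x : iG x \in X.
  apply: ext => h f; have -> : dd_elt dD (pure h f) * iG x = dd_elt dD
      (pure (h * bos x 1) (two_sided_shift f (bos x 1) (bos x^-1%g 1))).
    by rewrite -!dbl_hopf_dual -mulrA dbl_dual_grp mulrA dbl_hopfM.
  rewrite /p !triangular_coordE.
  rewrite (reindex_inj (mulIg x)) mulr_suml; apply: eq_bigr => s _ /=.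
  by rewrite bos_coord_mulg dbl_grpM -!mulrA -dbl_dual_grp -scalerAl mulrA.
rewrite dbl_ge0E; set gens := (X in agenv X).
have gensX : (gens <= X)%VS.
  rewrite !subv_add; apply/andP; split; [apply/andP; split|].
  - by apply/span_subvP=> _ /mapP[x _ ->]; apply: XG.
  - by apply/span_subvP=> _ /mapP[x _ ->]; apply: XF.
  - apply/subvP=> _ /memv_imgP[y _ ->]; rewrite linfunE; first exact: XF.
    exact: lin_dbl_vbar.
apply: agenv_sub_modl; first by rewrite -memvE.
exact: subv_trans (prodvS gensX (subvv X)) XX.
Qed.

Lemma vm_tensor_bilinear : bilinear_map T.
Proof. by case: (vm_tensorP vW) => [[]]. Qed.

Lemma lin_vt1 m : linear (T^~ m). Proof. by case: vm_tensor_bilinear. Qed.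
Lemma lin_vt2 d : linear (T d). Proof. by case: vm_tensor_bilinear. Qed.

Lemma vm_tensorA d a m : a \in ge0 -> T (d * a) m = T d (wact a m).
Proof.
move=> a_ge0; have [[_ bal] _] := vm_tensorP vW.
by rewrite -bal vsprojK.
Qed.

(** Right linearity of [triangular_coord] lets the contraction descend to the Verma module. These
    maps separate tensors, whence the injectivity in [verma_tensor_eq0]. *)
Lemma verma_coord (lam : dual R) :
  exists s : 'Hom(W, M), forall r m, s (T (iN r) m) = lam r *: m.
Proof.
have [_ univ] := vm_tensorP vW.
have [|phi [phiE _]] := univ M (fun d => wact (triangular_coord lam d)).
  split=> [|a d m].
    split=> [d|m]; first exact: lin_weight_act2.
    by move=> c d d'; rewrite lin_triangular_coord lin_weight_act1.
  rewrite triangular_coordM ?subvsP //; rewrite /weight_act.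
  have [_ _ actM] := wm_module wM; rewrite -actM; congr wm_act.
  apply: val_inj => /=; rewrite !vsprojK ?triangular_coord_ge0 //.
  by apply: dbl_ge0M; [apply: triangular_coord_ge0 | apply: subvsP].
exists phi => r m; rewrite phiE triangular_coord_nichols.
by rewrite (linearZE _ _ (lin_weight_act1 _ _)) weight_act1.
Qed.

Lemma verma_span (X : {vspace W}) :
  (forall r m, T (iN r) m \in X) -> forall w, w \in X.
Proof.
move=> TX; apply: (tensor_over_span (vm_tensorP vW)) => d m.
rewrite -(linfunE d (lin_vt1 m)) memv_preim;
  apply: (dbl_span (dD := dD)) => h f.
rewrite -memv_preim linfunE; last exact: lin_vt1.
rewrite -(bos_coordK bH h) (linear_sumE _ _ _ (lin_dbl_hopf dD)) mulr_suml.
rewrite (linear_sumE _ _ _ (lin_vt1 m)); apply: memv_suml => s _.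
rewrite dbl_hopf_bos -mulrA vm_tensorA //.
by apply: dbl_ge0M; [apply: dbl_grp_ge0 | apply: dbl_dual_ge0].
Qed.

Definition verma_tensor (S : tens R M) : W := \sw_(r, m <- S) T (iN r) m.

Lemma verma_tensor_bilinear : bilinear_map (fun r m => T (iN r) m).
Proof.
split=> [r|m]; first exact: lin_vt2.
by move=> c x y; rewrite lin_dbl_nichols lin_vt1.
Qed.

Lemma verma_tensor_onto w : exists S, w = verma_tensor S.
Proof.
have lT : linear verma_tensor by rewrite /verma_tensor; lin.
have: w \in limg (linfun verma_tensor).
  apply: verma_span => r m; have := memv_img (linfun verma_tensor) (memvf (pure
    r m)).
  by rewrite linfunE // /verma_tensor tlift_pure //;
    apply: verma_tensor_bilinear.
by case/memv_imgP=> S _ ->; exists S; rewrite linfunE.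
Qed.

Lemma verma_tensor_eq0 S : verma_tensor S = 0 -> S = 0.
Proof.
move=> S0; apply: tens_eq => lam; have [s sE] := verma_coord lam.
rewrite tlift0; transitivity (s (verma_tensor S)); last by rewrite S0 linear0.
rewrite /verma_tensor (lin_of_tlift _ _ (linearP s)).
by apply: eq_tlift => r m; rewrite /= sE.
Qed.

End Verma.

(** * The socle of a Verma module *)

Section VermaSocle.
Variables (k : fieldType) (gT : finGroupType).
Variables (V : vectType k) (ydV : yd_module gT V).
Variables (R : falgType k) (B : nichols_algebra ydV R).
Variables (H : falgType k) (hH : hopf_algebra H).
Variable bH : bosonization (na_hopf B) hH.
Variables (D : falgType k) (dD : drinfeld_double hH D).
Variables (g : gT) (U : vectType k) (rho : subg_of 'C[g]%G -> 'End(U)).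
Variables (M : vectType k) (wM : weight_module bH dD rho M).
Variables (W : vectType k) (vW : verma_module wM W).
Variables (n : nat) (top_n : is_top_degree B n).
Local Notation yd := (bh_yd (na_hopf B)).
Local Notation pr := (na_proj B).
Local Notation iN := (dbl_nichols bH dD).
Local Notation iG := (dbl_grp bH dD).
Local Notation iF := (dbl_dual dD).
Local Notation act := (vm_act vW).
Local Notation T := (vm_tensor vW).
Local Notation wact := (weight_act wM).
Local Notation Msoc := (verma_component vW n).
Local Notation Soc := (span_prod act (dbl_nichols_bar bH dD) Msoc).

Let lin_a1 w : linear (fun d => act d w). Proof. exact:
  lin_act1 (vm_module vW) w. Qed.
Let lin_a2 d : linear (act d). Proof. exact: lin_act2 (vm_module vW) d. Qed.
Let act1 w : act 1 w = w. Proof. by case: (vm_module vW). Qed.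
Let actB a b w : act (a - b) w = act a w - act b w.
Proof. by rewrite -scaleN1r addrC (lin_a1 w) scaleN1r addrC. Qed.
Let actM a b w : act (a * b) w = act a (act b w).
Proof. by case: (vm_module vW). Qed.

Lemma top_component_mem x m : pr n x = x -> T (iN x) m \in Msoc.
Proof.
move=> xn; apply: (span_prod_mem (b := fun r m => T (iN r) m)).
- exact: verma_tensor_bilinear.
- by rewrite -xn memv_img ?memvf.
- exact: memvf.
Qed.

Lemma top_component_ind (X : {vspace W}) :
  (forall x m, pr n x = x -> T (iN x) m \in X) -> forall w, w \in Msoc ->
    w \in X.
Proof.
by move=> TX; apply: span_prod_sub => x m xn _; apply/TX/na_proj_id.
Qed.

Lemma act_top_component d :
    (forall x m, pr n x = x -> act d (T (iN x) m) \in Msoc) ->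
  forall w, w \in Msoc -> act d w \in Msoc.
Proof.
move=> dM w wM'; suff: w \in (linfun (act d) @^-1: Msoc)%VS.
  by rewrite -memv_preim linfunE.
move: w wM'; apply: top_component_ind => x m xn.
by rewrite -memv_preim linfunE //; apply: dM.
Qed.

Lemma grp_top_component y w : w \in Msoc -> act (iG y) w \in Msoc.
Proof.
move: w; apply: act_top_component => x m xn.
rewrite vm_actE dbl_grp_nichols vm_tensorA ?dbl_grp_ge0 //.
by apply: top_component_mem; rewrite na_proj_act xn.
Qed.

Lemma fun_top_component f w : w \in Msoc -> act (dbl_fun bH dD f) w \in Msoc.
Proof.
move: w; apply: act_top_component => x m xn.
rewrite vm_actE dbl_fun_nichols (linear_sumE _ _ _ (lin_vt1 vW m)).
apply: memv_suml => t _; rewrite vm_tensorA ?dbl_dual_ge0 //.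
by apply: top_component_mem; rewrite na_proj_part xn.
Qed.

Lemma inj_top_component v w : w \in Msoc -> act (iN (na_inj B v)) w = 0.
Proof.
move=> wM'; apply/eqP; rewrite -(linfunE w (lin_a2 _)) -memv_ker; move: w wM'.
apply: top_component_ind => x m xn; rewrite memv_ker linfunE // vm_actE.
rewrite -dbl_nicholsM (na_top_left top_n xn) na_counit_inj scale0r.
by rewrite (linear0E (lin_dbl_nichols bH dD)) (linear0E (lin_vt1 vW m)).
Qed.

Lemma dual_top_component f w : w \in Msoc -> act (iF f) w \in Soc.
Proof.
move=> wM'; rewrite -(linfunE (iF f) (lin_a1 w)) memv_preim.
apply: subvP (dbl_dual_generated bH dD f); apply/prodvP=> x y xN yF.
rewrite -memv_preim linfunE // actM; apply: span_prod_mem => //.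
rewrite -(linfunE y (lin_a1 w)) memv_preim; apply: subvP yF.
apply/span_subvP=> _ /mapP[t _ ->]; rewrite -memv_preim linfunE //.
exact: fun_top_component.
Qed.

(** Gives the inclusion opposite to [dual_top_component]: to check stability of [Soc], its elements
    may be taken as arbitrary functionals applied to [Msoc]. *)
Lemma nichols_bar_dual x : x \in dbl_nichols_bar bH dD -> exists f, x = iF f.
Proof.
move=> xN; have lF := lin_dbl_dual dD.
suff: x \in limg (linfun iF) by case/memv_imgP=> f _ ->; exists f;
  rewrite linfunE.
have imF f : iF f \in limg (linfun iF) by rewrite -(linfunE f lF) memv_img
  ?memvf.
apply: subvP xN; apply: agenv_sub_modl; first by rewrite -memvE -(dbl_dual1 dD).
apply/prodvP=> _ _ /memv_imgP[y _ ->] /memv_imgP[f _ ->].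
rewrite !linfunE // ?[dbl_vbar _ _ _](erefl (iF _)); last exact: lin_dbl_vbar.
by rewrite -dbl_dualM.
Qed.

Lemma socle_ind (X : {vspace W}) :
    (forall f w, w \in Msoc -> act (iF f) w \in X) ->
  forall w, w \in Soc -> w \in X.
Proof.
move=> FX; apply: span_prod_sub => x w /nichols_bar_dual[f ->].
exact: FX.
Qed.

Lemma stabilizer_ind d :
    (forall f w, w \in Msoc -> act d (act (iF f) w) \in Soc) ->
  d \in stabilizer act Soc.
Proof.
move=> dS; apply/stabilizerP; first exact: vm_module.
move=> s sS; suff: s \in (linfun (act d) @^-1: Soc)%VS.
  by rewrite -memv_preim linfunE.
move: s sS; apply: socle_ind => f w wM'.
by rewrite -memv_preim linfunE //; apply: dS.
Qed.

Lemma grp_stabilizer y : iG y \in stabilizer act Soc.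
Proof.
apply: stabilizer_ind => f w wM'; rewrite -actM dbl_grp_dual actM.
by apply: dual_top_component; apply: grp_top_component.
Qed.

Lemma inj_stabilizer v : iN (na_inj B v) \in stabilizer act Soc.
Proof.
(* The commutation relation is available for homogeneous v only. *)
rewrite -(ydpart_counit ydV v) linear_sum (linear_sumE _ _ _ (lin_dbl_nichols bH
  dD)).
apply: memv_suml => t _; apply: stabilizer_ind => f w wM'.
have vt : ydpart ydV t (ydpart ydV t v) = ydpart ydV t v.
  by rewrite ydpart_coassoc eqxx.
rewrite -actM (dbl_nichols_dual bH dD f vt).
(* The term with V on the right dies on [Msoc]; the other two involve only functionals and a group
   element. *)
rewrite !actB !actM (inj_top_component _ wM') (linear0E (lin_a2 _)) sub0r.
rewrite rpredB ?rpredN //; first exact: dual_top_component.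
have /(stabilizerP (vm_module vW)) := grp_stabilizer t; apply.
exact: dual_top_component.
Qed.

Lemma stabilizerM a b : a \in stabilizer act Soc -> b \in stabilizer act Soc ->
  a * b \in stabilizer act Soc.
Proof.
have actP := vm_module vW.
move=> /(stabilizerP actP) sa /(stabilizerP actP) sb;
  apply/(stabilizerP actP)=> s sS.
by rewrite actM; apply/sa/sb.
Qed.

Lemma nichols_stabilizer r : iN r \in stabilizer act Soc.
Proof.
have lN := lin_dbl_nichols bH dD.
rewrite -(linfunE r lN) memv_preim; apply: (na_indl (B := B)) => [|v x].
  rewrite -memv_preim linfunE // dbl_nichols1; apply/stabilizerP;
    first exact: vm_module.
  by move=> s; rewrite act1.
rewrite -!memv_preim !linfunE // dbl_nicholsM.
by apply: stabilizerM; apply: inj_stabilizer.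
Qed.

Lemma dual_stabilizer f : iF f \in stabilizer act Soc.
Proof.
apply: stabilizer_ind => f' w wM'; rewrite -actM -dbl_dualM.
exact: dual_top_component.
Qed.

Lemma socle_submodule : submodule act Soc.
Proof.
move=> a; apply/(stabilizerP (vm_module vW)).
apply: (dbl_span (dD := dD)) => h f.
apply: stabilizerM; last exact: dual_stabilizer.
rewrite -(bos_coordK bH h) (linear_sumE _ _ _ (lin_dbl_hopf dD)).
apply: memv_suml => y _; rewrite dbl_hopf_bos.
by apply: stabilizerM; [apply: nichols_stabilizer | apply: grp_stabilizer].
Qed.

Section TopElement.
Variables (L : R) (t : gT).
Hypotheses (L_neq0 : L != 0) (Ln : pr n L = L) (Lt : ydpart yd t L = L).

(** V acts on the left factor alone, so by injectivity every contraction of w along M is an element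
    of B(V) killed by V, hence a multiple of L. The vector m is the contraction of w with a
    functional equal to 1 at L. *)
Lemma killed_top_component w :
  (forall v, act (iN (na_inj B v)) w = 0) -> exists m, w = T (iN L) m.
Proof.
move=> w0; have [S wS] := verma_tensor_onto vW w;
  have [lam lamL] := dual_separates L_neq0.
exists (\sw_(r, m <- S) (lam r *: m)).
have lN := lin_dbl_nichols bH dD.
have bT := verma_tensor_bilinear vW.
rewrite wS -[RHS](tlift_pure _ _ bT) -/(verma_tensor vW _); congr verma_tensor.
apply: tens_eqr => eta; rewrite tlift_pure; last by lin.
pose x := \sw_(r, m <- S) (eta m *: r).
have [|c xc] := na_top_span bH top_n L_neq0 Ln Lt (x := x).
  move=> v; have vS : \sw_(r, m <- S) pure (na_inj B v * r) m = 0.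
    apply: (verma_tensor_eq0 (vW := vW)); rewrite -[RHS](w0 v) wS.
    rewrite /verma_tensor tlift_tlift (lin_of_tlift _ _ (lin_a2 _)).
    apply: eq_tlift => r m; rewrite tlift_pure; last exact: bT.
    by rewrite vm_actE dbl_nicholsM.
  rewrite /x (lin_of_tlift _ _ (f := fun z => na_inj B v * z)); last by lin.
  rewrite -(tlift0 (fun r m => eta m *: r)) -vS tlift_tlift.
  by apply: eq_tlift => r m; rewrite tlift_pure ?scalerAr //; lin.
rewrite -/x xc; congr (_ *: _); transitivity (lam x).
  by rewrite xc linearZ /= lamL [_ *: 1]mulr1.
rewrite /x (lin_of_tlift _ _ (f := fun z => lam z)); last by lin.
rewrite (lin_of_tlift _ _ (f := fun z => eta z)); last by lin.
by apply: (@eq_tlift k R M k^o) => r m; rewrite !linearZ; apply: mulrC.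
Qed.

Lemma top_vector_neq0 m : m != 0 -> T (iN L) m != 0.
Proof.
have [lam lamL] := dual_separates L_neq0; have [s sE] := verma_coord vW lam.
by apply: contraNneq => T0; have := sE L m;
  rewrite T0 linear0 lamL scale1r => <-.
Qed.

Hypothesis irr_rho : is_irreducible_repr rho.

(** V is applied repeatedly to a nonzero vector of [N]: either a killed vector turns up, or elements
    of every degree i act nontrivially. *)
Lemma submodule_killed (N : {vspace W}) : submodule act N -> N != 0%VS ->
  exists2 w, w \in N & w != 0 /\ forall v, act (iN (na_inj B v)) w = 0.
Proof.
move=> subN N_neq0.
pose killed w := (forall v, act (iN (na_inj B v)) w = 0).
have step i : (exists2 w, w \in N & w != 0 /\ killed w) \/
    exists x w, [/\ pr i x = x, w \in N & act (iN x) w != 0].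
  elim: i => [|i [|[x [w [xi wN xw]]]]]; [right|by left|].
    exists 1, (vpick N); rewrite na_proj1E dbl_nichols1 act1 vpick0.
    by split; rewrite ?memv_pick.
  have lv : linear (fun v => act (iN (na_inj B v)) (act (iN x) w)).
    by move=> c u v; rewrite linearP lin_dbl_nichols lin_a1.
  (* Whether V kills the vector is decided on the image of a linear map, since equality of subspaces
     is decidable. *)
  have [im0|[v]] : limg (linfun (fun v =>
    act (iN (na_inj B v)) (act (iN x) w))) = 0%VS
     \/ exists v, act (iN (na_inj B v)) (act (iN x) w) != 0.
    have [->|] := eqVneq (limg (linfun (fun v =>
      act (iN (na_inj B v)) (act (iN x) w)))) 0%VS.
      by left.
    rewrite -subv0 => /subvPn[_ /memv_imgP[v _ ->]];
      rewrite memv0 linfunE // => ?.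
    by right; exists v.
  - left; exists (act (iN x) w); first exact: subN.
    split=> // v; apply/eqP; rewrite -memv0 -im0 -(linfunE v lv).
    by rewrite memv_img ?memvf.
  rewrite -actM -dbl_nicholsM => vx; right; exists (na_inj B v * x), w;
    split=> //.
  by rewrite -na_inj_proj -xi -[i.+1]add1n na_projM.
(* Degree [n.+1] is zero, which excludes the second alternative. *)
have [//|[x [w [xn _ /eqP[]]]]] := step n.+1.
rewrite -xn (na_proj_top top_n) // (linear0E (lin_dbl_nichols bH dD)).
exact: linear0E (lin_a1 w).
Qed.

Lemma top_component_sub (N : {vspace W}) : submodule act N -> N != 0%VS ->
  forall w, w \in Msoc -> w \in N.
Proof.
move=> subN N_neq0.
have lT x := lin_vt2 vW x.
pose N' := (linfun (T (iN L)) @^-1: N)%VS.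
have N'E m : (m \in N') = (T (iN L) m \in N) by rewrite -memv_preim linfunE.
have span x : pr n x = x -> exists c, x = c *: L.
  move=> xn; apply: (na_top_span bH top_n L_neq0 Ln Lt) => v.
  by rewrite (na_top_left top_n xn) na_counit_inj scale0r.
have N'full : N' = fullv.
  apply: (weight_module_simple irr_rho (wM := wM)).
  - have [w wN [w_neq0 /killed_top_component[m wm]]] :=
    submodule_killed subN N_neq0.
    apply: contraNneq w_neq0 => N'0; have : m \in N' by rewrite N'E -wm.
    by rewrite N'0 memv0 wm => /eqP ->; rewrite (linear0E (lT _)).
  - move=> y m; rewrite !N'E => /(subN (iG y)).
    (* The group acts on the line of L by scalars, nonzero because y is invertible, so the twist can
       be divided out. *)
    have [|c yc] := span (ydact yd y L); first by rewrite na_proj_act Ln.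
    rewrite vm_actE dbl_grp_nichols vm_tensorA ?dbl_grp_ge0 // yc.
    rewrite (linearZE _ _ (lin_dbl_nichols bH dD)) (linearZE _ _ (lin_vt1 vW
      _)).
    have c_neq0 : c != 0.
      apply: contraNneq L_neq0 => c0.
      by rewrite -(ydact1 yd L) -(mulVg y) ydactM yc c0 scale0r linear0.
    by rewrite rpredZeq (negPf c_neq0).
  (* Passing L, of degree t, translates a function by t; the translation by t^-1 is inserted to
     compensate. *)
  - move=> f m; rewrite !N'E => /(subN (dbl_fun bH dD (fun x =>
    f (t^-1 * x)%g))).
    rewrite vm_actE dbl_fun_nichols (bigD1 t) //= big1 ?addr0 => [|s neq].
      rewrite Lt vm_tensorA ?dbl_dual_ge0 //; congr (T _ (wact _ _) \in N).
      congr (iF _); apply: eq_fun_functional => x.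
      by rewrite mulKg.
    by rewrite -Lt ydpart_coassoc (negPf neq) (linear0E (lin_dbl_nichols bH dD))
      mul0r.
apply: top_component_ind => x m /span[c ->].
rewrite (linearZE _ _ (lin_dbl_nichols bH dD)) (linearZE _ _ (lin_vt1 vW _)).
by rewrite memvZ // -N'E N'full memvf.
Qed.

End TopElement.

Hypothesis irr_rho : is_irreducible_repr rho.

Lemma socle_sub (N : {vspace W}) :
  submodule act N -> N <> 0%VS -> (Soc <= N)%VS.
Proof.
move=> subN /eqP N_neq0; have [L [t [L_neq0 Ln Lt]]] := na_top_element top_n.
apply/subvP; apply: span_prod_sub => d w _ wM'; apply: (subN d).
exact: (top_component_sub L_neq0 Ln Lt irr_rho subN N_neq0).
Qed.

Lemma socle_neq0 : Soc <> 0%VS.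
Proof.
move=> Soc0; have [L [t [L_neq0 Ln Lt]]] := na_top_element top_n.
have [m m_neq0] := weight_module_neq0 wM irr_rho.
have /eqP[] := top_vector_neq0 L_neq0 m_neq0; apply/eqP; rewrite -memv0 -Soc0.
by rewrite -[T _ _]act1 -(dbl_dual1 dD);
  apply/dual_top_component/top_component_mem.
Qed.

End VermaSocle.

Theorem theorem2
  (k : closedFieldType) (char0 : [pchar k] =i pred0)
  (gT : finGroupType) (nonabelian_gT : ~~ abelian [set: gT])
  (V : vectType k) (ydV : yd_module gT V)
  (R : falgType k) (B : nichols_algebra ydV R)
  (H : falgType k) (hH : hopf_algebra H) (bH : bosonization (na_hopf B) hH)
  (D : falgType k) (dD : drinfeld_double hH D)
  (g : gT) (U : vectType k) (rho : subg_of 'C[g]%G -> 'End(U))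
  (irr_rho : is_irreducible_repr rho)
  (M : vectType k) (wM : weight_module bH dD rho M)
  (W : vectType k) (vW : verma_module wM W)
  (ntop : nat) (top_ntop : is_top_degree B ntop) :
  let Msoc := verma_component vW ntop in
  let S := span_prod (vm_act vW) (dbl_nichols_bar bH dD) Msoc in
  simple_submodule (vm_act vW) S /\
  (forall w : W, in_socle (vm_act vW) w <-> w \in S).
Proof.
move=> Msoc S; have subS : submodule (vm_act vW) S by apply: socle_submodule.
have S_min N : submodule (vm_act vW) N -> N <> 0%VS -> (S <= N)%VS.
  exact: socle_sub top_ntop irr_rho _.
have S_neq0 : S <> 0%VS by apply: socle_neq0 top_ntop irr_rho.
have simpleS : simple_submodule (vm_act vW) S.
  split=> // N subN leNS; have [->|/eqP N0] := eqVneq N 0%VS; first by left.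
  by right; apply/eqP; rewrite eqEsubv leNS S_min.
split=> // w; split=> [[s simple_s]|wS].
  apply: subvP; elim: s simple_s => [|N s IHs] simple_s;
    first by rewrite big_nil sub0v.
  rewrite big_cons subv_add IHs ?andbT => [|N' N's]; last first.
    by apply: simple_s; rewrite inE N's orbT.
  have [subN N0 minN] := simple_s N (mem_head N s).
  by have [//|<-] := minN S subS (S_min N subN N0).
exists [:: S] => [N|]; last by rewrite big_seq1.
by rewrite inE => /eqP ->.
Qed.
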